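(* Let $1<p<q$ be real numbers and let $X$ be a centered log-concave random variable. Then $$\frac{\lVert X\rVert_{q}}{\lVert X\rVert_{p}}\leq\max_{0\leq s\leq1}\frac{\lVert\Gamma^{s}\rVert_{q}}{\lVert\Gamma^{s}\rVert_{p}}.$$
   Context: A real random variable $X$ is log-concave if it has a density $f_X$ with respect to Lebesgue measure such that $\log f_X$ is concave on the support of $f_X$; it is centered if $\mathbb{E}[X]=0$. $\|X\|_r=(\mathbb{E}|X|^r)^{1/r}$. Let $\Gamma,\Gamma'$ be i.i.d. random variables with density $g(x)=e^{-(x+1)}1_{[-1,\infty)}(x)$, and for $0\le s\le 1$ let $$\Gamma^{s}=s\Gamma-(1-s)\Gamma'$$ (here $s$ is an index, not a power). *)

(* Defs.v *)
From HB Require Import structures.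
From mathcomp Require Import all_boot all_order all_algebra.
From mathcomp Require Import all_classical all_reals all_analysis.

Set Implicit Arguments.
Unset Strict Implicit.
Unset Printing Implicit Defensive.

Import Order.TTheory GRing.Theory Num.Theory.
Import numFieldNormedType.Exports.

Local Open Scope classical_set_scope.
Local Open Scope ring_scope.

Definition is_density d (T : measurableType d) (R : realType)
    (P : probability T R) (X : {RV P >-> R}) (f : R -> R) : Prop :=
  [/\ measurable_fun [set: R] f,
      forall x, 0 <= f x &
      forall A : set R, measurable A ->
        distribution P X A = (\int[lebesgue_measure]_(x in A) (f x)%:E)%E].

Definition concave_function (R : realType) (D : set R) (f : R -> R) : Prop :=
  convex_set (M := R^o) D /\ convex_function (E := R^o) D (\- f).

(* The support is {f > 0}; as ln 0 = 0 in the library, points where f vanishes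
   (where log f should be -oo) must be excluded explicitly. *)
Definition log_concave d (T : measurableType d) (R : realType)
    (P : probability T R) (X : {RV P >-> R}) : Prop :=
  exists f : R -> R,
    is_density X f /\ concave_function [set x | 0 < f x] (fun x => ln (f x)).

Definition centered d (T : measurableType d) (R : realType)
    (P : probability T R) (X : {RV P >-> R}) : Prop :=
  ('E_P[X] = 0)%E.

Definition independent_RV2 d (T : measurableType d) (R : realType)
    (P : probability T R) (X Y : {RV P >-> R}) : Prop :=
  forall A B : set R, measurable A -> measurable B ->
    P (X @^-1` A `&` Y @^-1` B) = (P (X @^-1` A) * P (Y @^-1` B))%E.

Definition gamma_pdf (R : realType) : R -> R :=
  (fun x : R => expR (- (x + 1))) \_ `[-1, +oo[.

Definition gamma_mix (R : realType) (T : Type) (G G' : T -> R) (s : R) : T -> R :=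
  fun w => s * G w - (1 - s) * G' w.

Definition norm_ratio d (T : measurableType d) (R : realType)
    (P : probability T R) (q p : R) (X : T -> R) : \bar R :=
  ('N[P]_q%:E[EFin \o X] / 'N[P]_p%:E[EFin \o X])%E.

(* Main.v *)
Require Import Defs.
From HB Require Import structures.
From mathcomp Require Import all_boot all_order all_algebra.
From mathcomp Require Import all_classical all_reals all_analysis.
From mathcomp Require Import measurable_realfun lebesgue_integral_under.
From mathcomp Require Import ring lra.

Set Implicit Arguments.
Unset Strict Implicit.
Unset Printing Implicit Defensive.

Import Order.TTheory GRing.Theory Num.Theory.
Import numFieldNormedType.Exports.

Local Open Scope classical_set_scope.
Local Open Scope ring_scope.

(** Let X be the given variable, with log-concave density f, and let Y = c * Gamma^s with
c > 0.  The density g of Y is a two-sided exponential: log g is affine on each side of a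
peak m, one side degenerating to g = 0 when s is 0 or 1.  The proof compares X and Y
through

    F y = E (X - y)_+ - E (Y - y)_+.

Both variables being centered, F y is also E (y - X)_+ - E (y - Y)_+; so F vanishes at both
infinities and F'' = f - g.  On each side of m the function log f - log g is concave, hence
f >= g on an interval there.  F is convex where f >= g and concave where f <= g, and these
facts together force the set where F >= 0 to be an interval ([sap_convex_nonneg],
[stop_loss_diff_convex_nonneg]).

Moments are weights of F: E X_+^r = r (r - 1) \int_0^oo y^(r - 2) E (X - y)_+ dy
([mean_pos_powR]).  Suppose that X and Y have the same E X_+^p and the same E X_-^p.  Then
the integrals of F with weight |y|^(p - 2) over the two half-lines vanish, so F >= 0
somewhere on each of them; as F >= 0 on an interval, F is first nonnegative and then
negative on (0, +oo).  Passing from the weight y^(p - 2) to y^(q - 2) favours the far,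
negative part, so E X_+^q <= E Y_+^q, and symmetrically for X_-
([stop_loss_weight_crossing], [pos_moment_comparison]).

It remains to find s and c.  For every s let c be the scale for which E |Y|^p = E |X|^p.
When s = 1, g vanishes to the left of m, so F >= 0 there; were E X_+^p > E Y_+^p, then F
would be nonnegative on the whole negative half-line as well and the total p-th moments
could not agree.  So E X_+^p <= E Y_+^p when s = 1, and by reflection the reverse holds when
s = 0 ([pos_moment_endpoint]).  The moments of Gamma^s depend continuously on s, by
dominated convergence, and the intermediate value theorem gives an s with equality
([log_concave_norm_ratio_le]).  The same continuity provides the maximum over s
([mixture_norm_ratio_max]). *)

(** * Positivity of a second antiderivative *)

Section sign_pattern.
Variable R : realType.

(** What remains of F'' = D, F(-oo) = F(+oo) = 0, once derivatives are avoided.  Each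
clause is the sign of an integral of D against a nonnegative kernel, and the list is
invariant under x |-> - x. *)
Record second_antiderivative_pattern (D F : R -> R) : Prop := SecondAntiderivative {
  sap_convex : forall u v w, u < v -> v < w ->
    (forall t, u < t -> t < w -> 0 <= D t) ->
    (w - u) * F v <= (w - v) * F u + (v - u) * F w ;
  sap_concave : forall u v w, u < v -> v < w ->
    (forall t, u < t -> t < w -> D t <= 0) ->
    (w - v) * F u + (v - u) * F w <= (w - u) * F v ;
  sap_left_ge0 : forall u, (forall t, t < u -> 0 <= D t) -> 0 <= F u ;
  sap_left_lt0 : forall u, (forall t, t < u -> D t < 0) -> F u < 0 ;
  sap_right_ge0 : forall u, (forall t, u < t -> 0 <= D t) -> 0 <= F u ;
  sap_right_lt0 : forall u, (forall t, u < t -> D t < 0) -> F u < 0 }.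

Lemma sap_opp (D F : R -> R) : second_antiderivative_pattern D F ->
  second_antiderivative_pattern (fun x => D (- x)) (fun x => F (- x)).
Proof.
case=> cv cc lg ll rg rl; split.
- move=> u v w uv vw DD.
  have H := cv (- w) (- v) (- u) _ _ _.
  suff : (- u - - w) * F (- v) <= (- u - - v) * F (- w) + (- v - - w) * F (- u) by lra.
  by apply: H => [||t wt tu]; [lra|lra|rewrite -(opprK t); apply: DD; lra].
- move=> u v w uv vw DD.
  have H := cc (- w) (- v) (- u) _ _ _.
  suff : (- u - - v) * F (- w) + (- v - - w) * F (- u) <= (- u - - w) * F (- v) by lra.
  by apply: H => [||t wt tu]; [lra|lra|rewrite -(opprK t); apply: DD; lra].
- by move=> u DD; apply: rg => t ut; rewrite -(opprK t); apply: DD; lra.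
- by move=> u DD; apply: rl => t ut; rewrite -(opprK t); apply: DD; lra.
- by move=> u DD; apply: lg => t ut; rewrite -(opprK t); apply: DD; lra.
- by move=> u DD; apply: ll => t ut; rewrite -(opprK t); apply: DD; lra.
Qed.

Definition convex_nonneg_on (A : R -> Prop) (D : R -> R) :=
  forall s t w, A s -> A w -> s < t -> t < w -> 0 <= D s -> 0 <= D w -> 0 <= D t.

(** Left of m, D is negative, then nonnegative on an interval I, then negative.  F is
negative up to the left end of I and convex on I, so once F is nonnegative it stays so up
to the right end x of I; beyond x, up to m, F is concave. *)
Lemma sap_left_peak (D F : R -> R) (m u : R) :
    second_antiderivative_pattern D F -> convex_nonneg_on (fun x => x <= m) D ->
    u <= m -> 0 <= F u ->
  exists2 x, u <= x <= m &
    (forall y, u <= y -> y <= x -> 0 <= F y) /\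
    (forall t, x < t -> t <= m -> D t <= 0).
Proof.
move=> [cv cc lg ll rg rl] iD um Fu.
(* Otherwise D < 0 on the whole half-line, and F u < 0. *)
have [t1 t1u Dt1] : exists2 t, t < u & 0 <= D t.
  apply: contrapT => /forall2NP nD.
  have : F u < 0 by apply: ll => t tu; case: (nD t) => // /negP; rewrite -ltNge.
  by rewrite ltNge Fu.
pose I := [set t | t <= m /\ 0 <= D t].
have I1 : I t1 by split=> //; apply: ltW; apply: lt_le_trans um.
have ubI : ubound I m by move=> t [].
have hsI : has_sup I by split; [exists t1|exists m].
have supm : sup I <= m by apply: ge_sup => //; exists t1.
have Dneg t : sup I < t -> t <= m -> D t < 0.
  move=> st tm; rewrite ltNge; apply/negP => Dt.
  have : t <= sup I by apply: ub_le_sup; [exists m|split].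
  by rewrite leNgt st.
have [su|us] := leP (sup I) u.
  exists u; first by rewrite lexx um.
  split=> [y uy yu|t ut tm]; first by have -> : y = u by lra.
  by apply/ltW/Dneg => //; apply: le_lt_trans ut.
exists (sup I); first by rewrite (ltW us) supm.
split=> [y uy ys|t st tm]; last by apply/ltW/Dneg.
have Dbetween s t : I s -> s < t -> t < sup I -> 0 <= D t.
  move=> [sm Ds] st tS.
  have [w [wm Dw] tw] := sup_gt (ex_intro _ t1 I1) tS.
  exact: (iD s t w).
move: uy; rewrite le_eqVlt => /predU1P[<-//|uy].
(* If I is unbounded below then D >= 0 everywhere to the left of y. *)
have [[l lI]|nlb] := pselect (has_lbound I); last first.
  apply: lg => t ty.
  have [s Is st] : exists2 s, I s & s < t.
    apply: contrapT => /forall2NP nI; apply: nlb; exists t => s Is.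
    by case: (nI s) => // /negP; rewrite -leNgt.
  by apply: (Dbetween s) => //; apply: lt_le_trans ys.
have hiI : has_inf I by split; [exists t1|exists l].
have infu : inf I < u by apply: le_lt_trans t1u; apply: ge_inf => //; exists l.
rewrite leNgt; apply/negP => Fy.
have Fi : F (inf I) < 0.
  apply: ll => t ti; rewrite ltNge; apply/negP => Dt.
  have : inf I <= t.
    apply: ge_inf; first by exists l.
    by split => //; rewrite (le_trans _ um)// ltW// (lt_trans ti).
  by rewrite leNgt ti.
have := cv _ _ _ infu uy _; rewrite leNgt => /(_ _)/negP; apply.
  by move=> t it ty; have [s Is st] := inf_lt (ex_intro _ t1 I1) it;
      apply: (Dbetween s) => //; apply: lt_le_trans ys.
have iy := lt_trans infu uy; nra.
Qed.

(** Around m, F is concave between the points given on each side by [sap_left_peak], and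
F is nonnegative at both of them. *)
Lemma sap_convex_nonneg (D F : R -> R) (m : R) :
    second_antiderivative_pattern D F ->
    convex_nonneg_on (fun x => x <= m) D -> convex_nonneg_on (fun x => m <= x) D ->
  convex_nonneg_on (fun=> True) F.
Proof.
move=> sDF Dl Dr u v w _ _ uv vw Fu Fw.
have chord x y : x < v -> v < y -> 0 <= F x -> 0 <= F y ->
    (forall t, x < t -> t < y -> D t <= 0) -> 0 <= F v.
  move=> xv vy Fx Fy Dxy; have := sap_concave sDF xv vy Dxy.
  have ? : x < y by lra.
  nra.
have peakl : u <= m -> 0 <= F v \/ exists x, [/\ x < v, x <= m, 0 <= F x &
    forall t, x < t -> t <= m -> D t <= 0].
  move=> um; have [x /andP[ux xm] [Fx Dx]] := sap_left_peak sDF Dl um Fu.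
  have [vx|xv] := leP v x; first by left; apply: Fx => //; exact: ltW.
  by right; exists x; split => //; apply: Fx.
have peakr : m <= w -> 0 <= F v \/ exists x, [/\ v < x, m <= x, 0 <= F x &
    forall t, m <= t -> t < x -> D t <= 0].
  move=> mw.
  have Dl' : convex_nonneg_on (fun x => x <= - m) (fun x => D (- x)).
    by move=> s t r sm rm st tr Ds Dt; apply: (Dr (- r) _ (- s)) => //; lra.
  have := sap_left_peak (sap_opp sDF) Dl' (_ : - w <= - m).
  rewrite lerN2 opprK => /(_ mw Fw)[x /andP[wx xm] [Fx Dx]].
  have [vx|xv] := leP (- v) x.
    by left; have := Fx (- v); rewrite opprK; apply => //; lra.
  right; exists (- x); split; [lra|lra|by apply: Fx|].
  by move=> t mt tx; rewrite -(opprK t); apply: Dx; lra.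
have [wm|mw] := leP w m.
  have /peakl[//|[x [xv xm Fx Dx]]] : u <= m by lra.
  by apply: (chord x w) => // t xt tw; apply: Dx; lra.
have [mu|um] := leP m u.
  have [//|[x [xv xm Fx Dx]]] := peakr (ltW mw).
  by apply: (chord u x) => // t xt tw; apply: Dx; lra.
have [//|[x [xv xm Fx Dx]]] := peakl (ltW um).
have [//|[y [vy my Fy Dy]]] := peakr (ltW mw).
apply: (chord x y) => // t xt ty.
by have [tm|mt] := leP t m; [exact: Dx|apply: Dy => //; exact: ltW].
Qed.
End sign_pattern.

(** * Integration against a density *)

HB.lock Definition mean (R : realType) (f phi : R -> R) : \bar R :=
  (\int[lebesgue_measure]_x (phi x * f x)%:E)%E.
Canonical unlockable_mean := Unlockable mean.unlock.

Section integrals_against_a_density.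
Variable R : realType.
Notation mu := (@lebesgue_measure R).
Implicit Types (f g phi psi : R -> R).

Definition pos (x : R) : R := Num.max x 0.

Lemma pos_ge0 x : 0 <= pos x.
Proof. by rewrite /pos le_max lexx orbT. Qed.

Lemma posE x : pos x = if 0 <= x then x else 0.
Proof. by rewrite /pos maxC; case: leP => //; rewrite maxElt. Qed.

Lemma posP x : (0 <= x /\ pos x = x) \/ (x < 0 /\ pos x = 0).
Proof. by rewrite posE; case: leP => h; [left|right]. Qed.

Lemma measurable_pos : measurable_fun [set: R] pos.
Proof. exact: measurable_maxr. Qed.

Record nonneg_measurable f : Prop := NonnegMeasurable {
  nnm_measurable : measurable_fun [set: R] f ;
  nnm_ge0 : forall x, 0 <= f x }.

Lemma nnmM f g : nonneg_measurable f -> nonneg_measurable g ->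
  nonneg_measurable (fun x => f x * g x).
Proof.
by move=> [mf f0] [mg g0]; split=> [|x]; [exact: measurable_funM|exact: mulr_ge0].
Qed.

Lemma nnmD f g : nonneg_measurable f -> nonneg_measurable g ->
  nonneg_measurable (fun x => f x + g x).
Proof.
by move=> [mf f0] [mg g0]; split=> [|x]; [exact: measurable_funD|exact: addr_ge0].
Qed.

Lemma nnm_cst (c : R) : 0 <= c -> nonneg_measurable (cst c).
Proof. by split. Qed.

Lemma nnm_pos f : measurable_fun [set: R] f -> nonneg_measurable (fun x => pos (f x)).
Proof.
move=> mf; split=> [|x]; last exact: pos_ge0.
exact: (measurableT_comp measurable_pos).
Qed.

Lemma nnm_posB (y : R) : nonneg_measurable (fun x => pos (x - y)).
Proof. by apply: nnm_pos; apply: measurable_funB. Qed.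

Lemma nnm_posBr (y : R) : nonneg_measurable (fun x => pos (y - x)).
Proof. by apply: nnm_pos; apply: measurable_funB. Qed.

Lemma nnm_posN : nonneg_measurable (fun x => pos (- x)).
Proof. by apply: nnm_pos; apply: oppr_measurable. Qed.

Lemma nnm_pos_id : nonneg_measurable pos.
Proof. by split; [exact: measurable_pos|exact: pos_ge0]. Qed.

Lemma nnm_EFin f (A : set R) : nonneg_measurable f -> measurable_fun A (fun x : R => (f x)%:E).
Proof. by move=> [mf _]; apply/measurable_EFinP; apply: measurable_funTS. Qed.

Lemma nnm_mul_ge0 f g x : nonneg_measurable f -> nonneg_measurable g ->
  (0 <= (f x * g x)%:E)%E.
Proof. by move=> [_ f0] [_ g0]; rewrite lee_fin mulr_ge0. Qed.

Lemma mean_ge0 f phi : nonneg_measurable f -> nonneg_measurable phi ->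
  (0 <= mean f phi)%E.
Proof. by move=> [_ f0] [_ p0]; rewrite unlock; apply: integral_ge0 => x _;
    rewrite lee_fin mulr_ge0. Qed.

Lemma meanD f phi psi : nonneg_measurable f -> nonneg_measurable phi ->
  nonneg_measurable psi ->
  (mean f (fun x => phi x + psi x)%R = mean f phi + mean f psi)%E.
Proof.
move=> nf np ns; rewrite unlock -ge0_integralD//.
- by apply: eq_integral => x _; rewrite -EFinD mulrDl.
- by move=> x _; exact: nnm_mul_ge0.
- by apply: nnm_EFin; exact: nnmM.
- by move=> x _; exact: nnm_mul_ge0.
- by apply: nnm_EFin; exact: nnmM.
Qed.

Lemma meanZ f phi (c : R) : 0 <= c -> nonneg_measurable f ->
  nonneg_measurable phi -> (mean f (fun x => c * phi x)%R = c%:E * mean f phi)%E.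
Proof.
move=> c0 nf np; rewrite unlock -ge0_integralZl//.
- by apply: eq_integral => x _; rewrite -EFinM mulrA.
- by apply: nnm_EFin; exact: nnmM.
- by move=> x _; exact: nnm_mul_ge0.
Qed.

Lemma le_mean f phi psi : nonneg_measurable f -> nonneg_measurable phi ->
  nonneg_measurable psi -> (forall x, phi x <= psi x) ->
  (mean f phi <= mean f psi)%E.
Proof.
move=> nf np ns pp; rewrite !unlock; apply: ge0_le_integral => //.
- by move=> x _; exact: nnm_mul_ge0.
- by apply: nnm_EFin; exact: nnmM.
- by apply: nnm_EFin; exact: nnmM.
- by move=> x _; rewrite lee_fin ler_wpM2r//; exact: (nnm_ge0 nf).
Qed.

Lemma eq_mean f phi psi : phi =1 psi -> mean f phi = mean f psi.
Proof. by move=> pp; rewrite !unlock; apply: eq_integral => x _; rewrite pp. Qed.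

End integrals_against_a_density.
Arguments pos {R} x.

(** * Strict monotonicity of the integral *)

Section strict_integral.
Local Open Scope ereal_scope.
Variables (d : measure_display) (T : measurableType d) (R : realType).
Variable mu : {measure set T -> \bar R}.

Lemma le_eq_integral_ae (D : set T) (f g : T -> R) : measurable D ->
  measurable_fun D f -> measurable_fun D g ->
  (forall x, D x -> (0 <= f x)%R /\ (f x <= g x)%R) ->
  \int[mu]_(x in D) (f x)%:E < +oo ->
  \int[mu]_(x in D) (f x)%:E = \int[mu]_(x in D) (g x)%:E ->
  {ae mu, forall x, D x -> f x = g x}.
Proof.
move=> mD mf mg fg foo fgE.
have If : mu.-integrable D (EFin \o f).
  apply/integrableP; split; first exact/measurable_EFinP.
  under eq_integral => x /set_mem Dx do rewrite gee0_abs ?lee_fin ?(fg _ Dx).1//.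
  by [].
have Ig : mu.-integrable D (EFin \o g).
  apply/integrableP; split; first exact/measurable_EFinP.
  under eq_integral => x /set_mem Dx.
    rewrite gee0_abs; last by rewrite lee_fin (le_trans (fg _ Dx).1 (fg _ Dx).2).
    over.
  by rewrite -[ltLHS]fgE.
have gf0 : \int[mu]_(x in D) `|(g x - f x)%:E| = 0.
  under eq_integral => x /set_mem Dx.
    rewrite gee0_abs; last by rewrite lee_fin subr_ge0 (fg _ Dx).2.
    rewrite EFinB; over.
  rewrite integralB//= fgE subee//.
  by rewrite -fgE ge0_fin_numE//; apply: integral_ge0 => x Dx; rewrite lee_fin (fg _ Dx).1.
have mgf : measurable_fun D (fun x => (g x - f x)%:E).
  by apply/measurable_EFinP; exact: measurable_funB.
have := (ae_eq_integral_abs mu mD mgf).1 gf0.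
apply: filterS => x /= /[apply] -[/eqP]; rewrite subr_eq0 => /eqP ->//.
Qed.

Lemma lt_integral (D : set T) (f g : T -> R) : measurable D -> mu D != 0 ->
  measurable_fun D f -> measurable_fun D g ->
  (forall x, D x -> (0 <= f x)%R /\ (f x < g x)%R) ->
  \int[mu]_(x in D) (f x)%:E < +oo ->
  \int[mu]_(x in D) (f x)%:E < \int[mu]_(x in D) (g x)%:E.
Proof.
move=> mD D0 mf mg fg foo; rewrite lt_neqAle; apply/andP; split; last first.
  apply: ge0_le_integral => //.
  - by move=> x Dx; rewrite lee_fin (fg _ Dx).1.
  - exact/measurable_EFinP.
  - exact/measurable_EFinP.
  - by move=> x Dx; rewrite lee_fin ltW// (fg _ Dx).2.
have fg' x : D x -> (0 <= f x)%R /\ (f x <= g x)%R by move=> /fg[? /ltW].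
apply/eqP => /(le_eq_integral_ae mD mf mg fg' foo)[N [mN N0 DN]].
move: D0; rewrite -measure_le0 -N0 => /negP; apply; apply: le_measure; rewrite ?inE//.
move=> x Dx; apply: DN => /= /(_ Dx) fgx.
by have := (fg _ Dx).2; rewrite fgx ltxx.
Qed.

End strict_integral.

(** * The function y |-> E (X - y)_+ *)

Section stop_loss_transform.
Variable R : realType.
Notation mu := (@lebesgue_measure R).
Implicit Types (f g phi psi : R -> R).

(** Known as the stop-loss transform, or the price of a call option with strike y. *)
Definition stop_loss f (y : R) : \bar R := mean f (fun x => pos (x - y)).

Record centered_density f : Prop := CenteredDensity {
  cd_nnm : nonneg_measurable f ;
  cd_mass : mean f (cst 1) = 1%E ;
  cd_fin : (mean f pos < +oo)%E ;
  cd_balance : mean f (fun x => pos (- x)) = mean f pos }.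

Definition rstop_loss f (y : R) : R := fine (stop_loss f y).

Lemma mean_cst f (c : R) : centered_density f -> 0 <= c -> mean f (fun=> c) = c%:E.
Proof.
move=> cf c0; have nf := cd_nnm cf.
rewrite (@eq_mean _ _ _ (fun x => c * cst 1 x)); last by move=> x; rewrite /= mulr1.
by rewrite meanZ// (cd_mass cf) mule1.
Qed.

Lemma stop_lossE f y : centered_density f -> stop_loss f y = (rstop_loss f y)%:E.
Proof.
move=> cf; have nf := cd_nnm cf.
rewrite fineK// ge0_fin_numE; last exact: mean_ge0 (nnm_posB y).
apply: (@le_lt_trans _ _ (mean f (fun x => pos x + `|y|))).
  apply: le_mean => //; first exact: nnm_posB.
    by apply: nnmD; [exact: nnm_pos_id|exact: nnm_cst].
  move=> x; have [[h ->]|[h ->]] := posP (x - y); have [[k ->]|[k ->]] := posP x;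
  have := ler_norm y; have := ler_norm (- y); rewrite normrN; lra.
rewrite meanD//; last exact: nnm_pos_id.
by rewrite (mean_cst cf)// lte_add_pinfty// ?ltry//; exact: cd_fin.
Qed.

Lemma rstop_loss_ge0 f y : centered_density f -> 0 <= rstop_loss f y.
Proof. by move=> cf; apply: fine_ge0; apply: mean_ge0 (cd_nnm cf) (nnm_posB y). Qed.

(** Put-call parity: (x - y)_+ - (y - x)_+ = x - y, and the mean is zero. *)
Lemma mean_pos_opp f y : centered_density f ->
  mean f (fun x => pos (y - x)) = (rstop_loss f y + y)%:E.
Proof.
move=> cf; have nf := cd_nnm cf.
have H : (mean f (fun x => pos (y - x)) + mean f pos + (pos (- y))%:E =
          stop_loss f y + mean f (fun x => pos (- x)) + (pos y)%:E)%E.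
  rewrite -(mean_cst cf (pos_ge0 (- y))) -(mean_cst cf (pos_ge0 y)) /stop_loss.
  have nB := nnm_posB y. have nBr := nnm_posBr y.
  have nN := @nnm_posN R. have nI := @nnm_pos_id R.
  rewrite -!meanD//; try exact: nnm_cst; try exact: pos_ge0; try exact: nnmD.
  - apply: eq_mean => x /=.
    have [[h ->]|[h ->]] := posP (x - y); have [[h' ->]|[h' ->]] := posP (y - x);
    have [[k ->]|[k ->]] := posP x; have [[k' ->]|[k' ->]] := posP (- x);
    have [[l ->]|[l ->]] := posP y; have [[l' ->]|[l' ->]] := posP (- y); lra.
  - by apply: nnm_cst; exact: pos_ge0.
  - by apply: nnm_cst; exact: pos_ge0.
move: H; rewrite (cd_balance cf) (stop_lossE y cf).
have : mean f pos \is a fin_num.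
  by rewrite ge0_fin_numE ?(cd_fin cf)//; apply: mean_ge0 => //; exact: nnm_pos_id.
case: (mean f pos) => // b _.
case: (mean f (fun x => pos (y - x))) => //= a [H]; congr (_%:E); move: H.
by have [[l ->]|[l ->]] := posP y; have [[l' ->]|[l' ->]] := posP (- y); lra.
Qed.

(** The second difference of y |-> (x - y)_+ on u < v < w is a bump supported in [u, w]. *)
Lemma chord_pos (u v w x : R) : u < v -> v < w ->
  let k := (w - v) * pos (x - u) + (v - u) * pos (x - w) - (w - u) * pos (x - v) in
  0 <= k /\ (x <= u \/ w <= x -> k = 0).
Proof.
move=> uv vw /=.
by have [[a ->]|[a ->]] := posP (x - u); have [[b ->]|[b ->]] := posP (x - v);
   have [[c ->]|[c ->]] := posP (x - w); split; [nra|move=> [h|h]; nra|..]; 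
   try nra; move=> [h|h]; nra.
Qed.

Lemma nnm_chord (u v w : R) : u < v -> v < w ->
  nonneg_measurable (fun x => (w - v) * pos (x - u) + (v - u) * pos (x - w)
                              - (w - u) * pos (x - v)).
Proof.
move=> uv vw; split=> [|x]; last by have [] := chord_pos x uv vw.
have mZ (c : R) y : measurable_fun [set: R] (fun x => c * pos (x - y)).
  by apply: measurable_funM => //; apply: nnm_measurable; exact: nnm_posB.
by apply: measurable_funB => //; exact: measurable_funD.
Qed.

Lemma rstop_loss_chord f (u v w : R) : centered_density f -> u < v -> v < w ->
  mean f (fun x => (w - v) * pos (x - u) + (v - u) * pos (x - w)
                   - (w - u) * pos (x - v)) =
  ((w - v) * rstop_loss f u + (v - u) * rstop_loss f w
   - (w - u) * rstop_loss f v)%:E.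
Proof.
move=> cf uv vw; have nf := cd_nnm cf; set k := (fun x => _).
have nB y := nnm_posB y.
have nZ (c : R) y : 0 <= c -> nonneg_measurable (fun x => c * pos (x - y)).
  by move=> c0; apply: nnmM => //; exact: nnm_cst.
have nk : nonneg_measurable k by exact: nnm_chord.
have : mean f (fun x => k x + (w - u) * pos (x - v)) =
       mean f (fun x => (w - v) * pos (x - u) + (v - u) * pos (x - w)).
  by apply: eq_mean => x; rewrite /k subrK.
have [? ? ?] : [/\ 0 <= w - u, 0 <= w - v & 0 <= v - u] by split; lra.
rewrite (meanD nf nk (nZ _ _ _))// (meanD nf (nZ _ _ _) (nZ _ _ _))//.
rewrite !meanZ//.
rewrite -!/(stop_loss _ _) !stop_lossE// -!EFinM -EFinD.
by case: (mean f k) => //= a [H]; congr EFin; lra.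
Qed.

(** Convexity and concavity come from integrating f - g against the bump of [chord_pos].
The clauses on the left half-line use parity to replace (x - u)_+ by (u - x)_+, whose
support is that half-line. *)
Lemma stop_loss_pattern f g : centered_density f -> centered_density g ->
  second_antiderivative_pattern (fun x => f x - g x)
    (fun y => rstop_loss f y - rstop_loss g y).
Proof.
move=> cf cg.
have half (h1 h2 phi : R -> R) (A : set R) : measurable A -> mu A != 0%E ->
    centered_density h1 -> centered_density h2 ->
    nonneg_measurable phi -> (forall x, ~ A x -> phi x = 0) ->
    (forall x, A x -> 0 < phi x /\ h1 x < h2 x) -> (mean h1 phi < +oo)%E ->
    (mean h1 phi < mean h2 phi)%E.
  move=> mA A0 c1 c2 np pA hA fin; have n1 := cd_nnm c1; have n2 := cd_nnm c2.
  have restr h : centered_density h -> mean h phi = (\int[mu]_(x in A) (phi x * h x)%:E)%E.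
    move=> ch; rewrite unlock [RHS]integral_mkcond; apply: eq_integral => x _.
    by rewrite patchE; case: ifPn => // /negP; rewrite inE => /pA ->; rewrite mul0r.
  rewrite restr// [ltRHS]restr//; apply: lt_integral => //.
  - by apply: measurable_funTS; apply: nnm_measurable; apply: nnmM.
  - by apply: measurable_funTS; apply: nnm_measurable; apply: nnmM.
  - move=> x /hA[px hx]; split; first by rewrite (mulr_ge0 (ltW px))//; exact: (nnm_ge0 n1).
    by rewrite ltr_pM2l.
  - by rewrite -restr.
have weak (h1 h2 phi : R -> R) :
    centered_density h1 -> centered_density h2 -> nonneg_measurable phi ->
    (forall x, phi x = 0 \/ h1 x <= h2 x) -> (mean h1 phi <= mean h2 phi)%E.
  move=> c1 c2 np H; have n1 := cd_nnm c1; have n2 := cd_nnm c2;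
      rewrite !unlock; apply: ge0_le_integral => //.
  - by move=> x _; exact: nnm_mul_ge0 n1.
  - by apply: nnm_EFin; exact: nnmM.
  - by apply: nnm_EFin; exact: nnmM.
  - move=> x _; rewrite lee_fin; case: (H x) => [->|h]; first by rewrite !mul0r.
    by rewrite ler_wpM2l//; exact: (nnm_ge0 np).
have chord h1 h2 u v w : centered_density h1 -> centered_density h2 ->
    u < v -> v < w -> (forall t, u < t -> t < w -> h1 t <= h2 t) ->
    (w - v) * rstop_loss h1 u + (v - u) * rstop_loss h1 w - (w - u) * rstop_loss h1 v <=
    (w - v) * rstop_loss h2 u + (v - u) * rstop_loss h2 w - (w - u) * rstop_loss h2 v.
  move=> c1 c2 uv vw H; rewrite -lee_fin -!rstop_loss_chord//.
  apply: weak => //; first exact: nnm_chord.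
  move=> x; have [xu|ux] := leP x u; first by left; apply: (chord_pos x uv vw).2; left.
  have [wx|xw] := leP w x; first by left; apply: (chord_pos x uv vw).2; right.
  by right; apply: H.
have mray (u : R) : mu `]-oo, u[%classic != 0%E /\ mu `]u, +oo[%classic != 0%E.
  by split; rewrite lebesgue_measure_itv/= ?ltNyr ?ltry.
split.
- move=> u v w uv vw H.
  have /chord : forall t, u < t -> t < w -> g t <= f t.
    by move=> t ut tw; rewrite -subr_ge0 H.
  by move=> /(_ v cg cf uv vw); lra.
- move=> u v w uv vw H.
  have /chord : forall t, u < t -> t < w -> f t <= g t.
    by move=> t ut tw; rewrite -subr_le0 H.
  by move=> /(_ v cf cg uv vw); lra.
- move=> u H; suff : rstop_loss g u + u <= rstop_loss f u + u by lra.
  rewrite -lee_fin -!mean_pos_opp//; apply: weak => //; first exact: nnm_posBr.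
  move=> x; have [[h ->]|[h ->]] := posP (u - x); last by left.
  have [xu|ux] := ltP x u; first by right; rewrite -subr_ge0 H.
  by left; lra.
- move=> u H; suff : rstop_loss f u + u < rstop_loss g u + u by lra.
  rewrite -lte_fin -!mean_pos_opp//; apply: (half _ _ _ `]-oo, u[%classic) => //.
  + exact: (mray u).1.
  + exact: nnm_posBr.
  + by move=> x; rewrite /= in_itv/= => /negP; rewrite -leNgt;
      have [[h ->]|[h ->]] := posP (u - x); lra.
  + move=> x; rewrite /= in_itv/= => xu; have := H _ xu.
    by have [[h ->]|[h ->]] := posP (u - x); lra.
  + by rewrite mean_pos_opp// ltry.
- move=> u H; suff : rstop_loss g u <= rstop_loss f u by lra.
  rewrite -lee_fin -!stop_lossE//; apply: weak => //; first exact: nnm_posB.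
  move=> x; have [[h ->]|[h ->]] := posP (x - u); last by left.
  have [xu|ux] := ltP u x; first by right; rewrite -subr_ge0 H.
  by left; lra.
- move=> u H; suff : rstop_loss f u < rstop_loss g u by lra.
  rewrite -lte_fin -!stop_lossE//; apply: (half _ _ _ `]u, +oo[%classic) => //.
  + exact: (mray u).2.
  + exact: nnm_posB.
  + by move=> x; rewrite /= in_itv/= andbT => /negP; rewrite -leNgt;
      have [[h ->]|[h ->]] := posP (x - u); lra.
  + move=> x; rewrite /= in_itv/= andbT => xu; have := H _ xu.
    by have [[h ->]|[h ->]] := posP (x - u); lra.
  + by have := stop_lossE u cf; rewrite /stop_loss => ->; rewrite ltry.
Qed.
End stop_loss_transform.

(** * Log-concave densities *)

Section log_concave_densities.
Variable R : realType.
Notation mu := (@lebesgue_measure R).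
Implicit Types (f g phi psi : R -> R).

(** Cleared of denominators, concavity of ln f on the convex set f > 0 reads as follows. *)
Definition log_concave_fun f := forall u v w, u < v -> v < w -> 0 < f u -> 0 < f w ->
  0 < f v /\ (w - v) * ln (f u) + (v - u) * ln (f w) <= (w - u) * ln (f v).

Lemma log_concave_funP f :
  concave_function [set x | 0 < f x] (fun x => ln (f x)) -> log_concave_fun f.
Proof.
move=> [cs cf] u v w uv vw fu fw.
have wu : 0 < w - u by lra.
have t0 : 0 <= (w - v) / (w - u) by rewrite divr_ge0; lra.
have t1 : (w - v) / (w - u) <= 1 by rewrite ler_pdivrMr; lra.
have tv : (w - v) / (w - u) * u + (1 - (w - v) / (w - u)) * w = v.
  by field; lra.
have Au : (u : convex_lmodType R^o) \in [set x | 0 < f x] by rewrite inE.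
have Aw : (w : convex_lmodType R^o) \in [set x | 0 < f x] by rewrite inE.
have fv : 0 < f v by have := cs _ _ (Itv01 t0 t1) Au Aw; rewrite inE -{2}tv.
split=> //.
have : - ln (f ((w - v) / (w - u) * u + (1 - (w - v) / (w - u)) * w)) <=
    (w - v) / (w - u) * - ln (f u) + (1 - (w - v) / (w - u)) * - ln (f w) :=
  cf (Itv01 t0 t1) _ _ Au Aw.
rewrite tv.
have -> : 1 - (w - v) / (w - u) = (v - u) / (w - u) by field; lra.
move=> H; suff : ((w - v) * ln (f u) + (v - u) * ln (f w)) / (w - u) <= ln (f v).
  by rewrite ler_pdivrMr// [ln (f v) * _]mulrC.
have -> : ((w - v) * ln (f u) + (v - u) * ln (f w)) / (w - u) =
  (w - v) / (w - u) * ln (f u) + (v - u) / (w - u) * ln (f w) by field; lra.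
by lra.
Qed.

Definition log_affine_on (A : R -> Prop) g :=
  exists c k : R, forall x, A x -> g x = expR (c + k * x).

(** The null alternatives cover the one-sided exponentials, where the peak is an end of the
support. *)
Record two_sided_exponential g (m : R) : Prop := TwoSidedExponential {
  tse_left : log_affine_on (fun x => x <= m) g \/ (forall x, x < m -> g x = 0) ;
  tse_right : log_affine_on (fun x => m <= x) g \/ (forall x, m < x -> g x = 0) }.

(** ln f minus an affine function is concave, so it is nonnegative on an interval. *)
Lemma log_concave_dominates f g (A : R -> Prop) : log_concave_fun f ->
    (forall u v w, A u -> A w -> u < v -> v < w -> A v) -> log_affine_on A g ->
  convex_nonneg_on A (fun x => f x - g x).
Proof.
move=> lf cA [c [k gE]] u v w Au Aw uv vw; have Av := cA _ _ _ Au Aw uv vw.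
rewrite !subr_ge0 !gE// => fu fw.
have fu0 := lt_le_trans (expR_gt0 _) fu; have fw0 := lt_le_trans (expR_gt0 _) fw.
have [fv0 H] := lf _ _ _ uv vw fu0 fw0.
move: fu fw; rewrite -{1}(lnK fu0) -{1}(lnK fw0) -(lnK fv0) !ler_expR => fu fw.
have wu : 0 < w - u by lra.
rewrite -(ler_pM2l wu); apply: le_trans H.
have := ler_wpM2l (_ : 0 <= w - v) fu; have := ler_wpM2l (_ : 0 <= v - u) fw.
move=> /(_ ltac:(lra)) ? /(_ ltac:(lra)) ?; lra.
Qed.

Lemma log_concave_tse f g m : (forall x, 0 <= f x) -> log_concave_fun f ->
    two_sided_exponential g m ->
  convex_nonneg_on (fun x => x <= m) (fun x => f x - g x) /\
  convex_nonneg_on (fun x => m <= x) (fun x => f x - g x).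
Proof.
move=> f0 lf [gl gr]; split.
- case: gl => [gl|g0]; first by apply: log_concave_dominates => // u v w; lra.
  by move=> u v w um wm uv vw _ _; rewrite g0 ?subr0//; lra.
- case: gr => [gr|g0]; first by apply: log_concave_dominates => // u v w; lra.
  by move=> u v w um wm uv vw _ _; rewrite g0 ?subr0//; lra.
Qed.

Lemma integral_oppr (h : R -> \bar R) : measurable_fun [set: R] h ->
  (forall x, 0 <= h x)%E -> (\int[mu]_x h (- x)%R = \int[mu]_x h x)%E.
Proof.
move=> mh h0.
transitivity (\int[pushforward mu (-%R : R -> measurableTypeR R)]_x h x)%E.
  by rewrite ge0_integral_pushforward//; exact: oppr_measurable.
by apply: eq_measure_integral => A mA _; exact: lebesgue_measureN.
Qed.

Definition flip f : R -> R := fun x => f (- x).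

Lemma flip_nnm f : nonneg_measurable f -> nonneg_measurable (flip f).
Proof.
move=> [mf f0]; split=> [|x]; last exact: f0.
by apply: (measurableT_comp mf); exact: oppr_measurable.
Qed.

Lemma mean_flip f phi : nonneg_measurable f -> nonneg_measurable phi ->
  mean (flip f) phi = mean f (fun x => phi (- x)).
Proof.
move=> nf np; rewrite !unlock -[RHS]integral_oppr.
- by apply: eq_integral => x _; rewrite opprK.
- by apply: nnm_EFin; apply: nnmM => //; exact: (flip_nnm np).
- by move=> x; apply: (@nnm_mul_ge0 _ (flip phi)) => //; exact: flip_nnm.
Qed.

Lemma flip_log_concave f : log_concave_fun f -> log_concave_fun (flip f).
Proof.
move=> lf u v w uv vw fu fw.
have [||fv H] := lf (- w) (- v) (- u) _ _ fw fu; [lra|lra|].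
by rewrite /flip; split => //; lra.
Qed.

Lemma flip_centered f : centered_density f -> centered_density (flip f).
Proof.
move=> cf; have nf := cd_nnm cf; have nN := @nnm_posN R; have nI := @nnm_pos_id R.
split; first exact: flip_nnm.
- by rewrite mean_flip// ?(cd_mass cf).
- by rewrite mean_flip// (cd_balance cf); exact: cd_fin.
- rewrite !mean_flip// (cd_balance cf); apply: eq_mean => x.
  by rewrite opprK.
Qed.

Lemma rstop_loss_flip f y : centered_density f ->
  rstop_loss (flip f) y = rstop_loss f (- y) - y.
Proof.
move=> cf; rewrite {1}/rstop_loss /stop_loss mean_flip//; last 2 first.
- exact: cd_nnm.
- exact: nnm_posB.
rewrite (@eq_mean _ _ _ (fun x => pos (- y - x))); last by move=> x; rewrite addrC.
by rewrite mean_pos_opp.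
Qed.

(** An integrable density cannot be nondecreasing, so f x1 < f x0 for some x0 < x1; by
concavity ln f lies, beyond x1, below the line through its values at x0 and x1. *)
Lemma log_concave_exponential_tail f : nonneg_measurable f -> log_concave_fun f ->
    mean f (cst 1) = 1%E ->
  exists a A k, 0 < k /\ forall x, a <= x -> f x <= A * expR (- k * x).
Proof.
move=> nf lf f1.
have [x0 fx0] : exists x0, 0 < f x0.
  apply: contrapT => /forallNP nf0; move: f1; rewrite unlock integral0_eq.
    by move=> /eqP; rewrite eq_sym onee_eq0.
  move=> x _; have := nnm_ge0 nf x; rewrite le_eqVlt => /orP[/eqP <-|/nf0//].
  by rewrite mulr0.
have [x1 x01 fx1] : exists2 x1, x0 < x1 & f x1 < f x0.
  apply: contrapT => /forall2NP H.
  have : (\int[mu]_(x in `]x0, +oo[%classic) (f x0)%:E <= mean f (cst 1%R))%E.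
    rewrite [leLHS]integral_mkcond unlock; apply: ge0_le_integral => //.
    - by move=> x _; rewrite patchE; case: ifP => // _; rewrite lee_fin ltW.
    - by apply/(measurable_restrictT _ _).1.
    - by apply: nnm_EFin; apply: nnmM => //; exact: nnm_cst.
    - move=> x _; rewrite patchE; case: ifPn => [|_].
        rewrite inE/= in_itv/= andbT => xx; rewrite lee_fin mul1r leNgt; apply/negP.
        by move=> h; case: (H x).
      by rewrite lee_fin mul1r (nnm_ge0 nf).
  rewrite f1 integral_cst//= lebesgue_measure_itv/= ltry mulry gtr0_sg// mul1e.
  by rewrite leye_eq.
exists x1.
have := nnm_ge0 nf x1; rewrite le_eqVlt => /orP[/eqP f10|f10].
  exists (f x1), 1; split=> // x; rewrite le_eqVlt => /orP[/eqP<-|xx].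
    by rewrite -f10 mul0r.
  rewrite -f10 mul0r leNgt; apply/negP => fx.
  by have [] := lf _ _ _ x01 xx fx0 fx; rewrite -f10 ltxx.
pose k := (ln (f x0) - ln (f x1)) / (x1 - x0).
have k0 : 0 < k by rewrite divr_gt0 ?subr_gt0// ltr_ln.
have kE : k * (x1 - x0) = ln (f x0) - ln (f x1) :> R.
  by rewrite divfK// gt_eqF// subr_gt0.
exists (expR (ln (f x1) + k * x1)), k; split=> // x xx.
rewrite -expRD; have := nnm_ge0 nf x; rewrite le_eqVlt => /orP[/eqP <-|fx].
  exact: expR_ge0.
rewrite -{1}(lnK fx) ler_expR; move: xx; rewrite le_eqVlt => /orP[/eqP<-|xx]; first lra.
have [_ H] := lf _ _ _ x01 xx fx0 fx.
have e : ln (f x0) = k * (x1 - x0) + ln (f x1) by lra.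
move: H; rewrite e => H.
have : (x1 - x0) * ln (f x) <= (x1 - x0) * (ln (f x1) + k * x1 + - k * x) by lra.
by rewrite ler_pM2l// subr_gt0.
Qed.

Lemma powR_le_expR (r k x : R) : 0 < r -> 0 < k -> 0 <= x ->
  x `^ r <= (r / k) `^ r * expR (k * x).
Proof.
move=> r0 k0 x0; have rk : 0 < r / k by rewrite divr_gt0.
have -> : expR (k * x) = expR (k * x / r) `^ r.
  by rewrite /powR expR_eq0 expRK [r * _]mulrC divfK ?gt_eqF.
rewrite -powRM ?expR_ge0 ?(ltW rk)//.
apply: ge0_ler_powR; rewrite ?nnegrE//; [exact: ltW|by rewrite mulr_ge0 ?expR_ge0// ltW|].
(* With t = k x / r, this is t <= expR t. *)
have xE : x = r / k * (k * x / r) by field; rewrite !gt_eqF.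
rewrite {1}xE ler_pM2l//; apply: le_trans (expR_ge1Dx _); lra.
Qed.

Lemma log_concave_moment f (r : R) : nonneg_measurable f -> log_concave_fun f ->
  mean f (cst 1) = 1%E -> 0 < r -> (mean f (fun x => pos x `^ r)%R < +oo)%E.
Proof.
move=> nf lf f1 r0; have [a [A [k [k0 fA]]]] := log_concave_exponential_tail nf lf f1.
(* Half of the decay rate absorbs the power, the other half ensures integrability. *)
pose h := k / 2; have h0 : 0 < h by rewrite /h; lra.
pose C := (r / h) `^ r * `|A| / h.
have C0 : 0 <= C by rewrite /C !mulr_ge0 ?powR_ge0// invr_ge0 ltW.
have npos : nonneg_measurable (fun x : R => pos x `^ r).
  split=> [|x]; last exact: powR_ge0.
  by apply: (measurableT_comp (@measurable_powR R r)); exact: measurable_pos.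
have nexp : nonneg_measurable (exponential_pdf h).
  split; first exact: measurable_exponential_pdf.
  by move=> x; apply: exponential_pdf_ge0; exact: ltW.
apply: (@le_lt_trans _ _ (\int[mu]_x (pos a `^ r * f x + C * exponential_pdf h x)%:E)%E).
  rewrite unlock; apply: ge0_le_integral => //.
  - by move=> x _; exact: (nnm_mul_ge0 _ npos nf).
  - by apply: nnm_EFin; exact: nnmM.
  - apply: nnm_EFin; apply: nnmD; apply: nnmM => //; apply: nnm_cst => //.
    exact: powR_ge0.
  - move=> x _; rewrite lee_fin; have fx := nnm_ge0 nf x.
    have [xa|ax] := leP x (pos a).
      apply: (@le_trans _ _ (pos a `^ r * f x)); last first.
        by rewrite lerDl mulr_ge0// (nnm_ge0 nexp).
      apply: ler_wpM2r => //; apply: ge0_ler_powR; rewrite ?nnegrE ?pos_ge0 ?(ltW r0)//.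
      by have [[? ->]|[? ->]] := posP x => //; exact: pos_ge0.
    have x0 : 0 < x by apply: le_lt_trans ax; exact: pos_ge0.
    have {}ax : a < x by move: ax; have [[? ->]|[? ->]] := posP a; lra.
    apply: (@le_trans _ _ (C * exponential_pdf h x)); last first.
      by rewrite lerDr mulr_ge0// powR_ge0.
    rewrite exponential_pdfE; last exact: ltW.
    have -> : pos x = x by have [[? ->]|[? ->]] := posP x => //; lra.
    have H2 := fA x (ltW ax); have H1 := powR_le_expR r0 h0 (ltW x0).
    apply: (@le_trans _ _ ((r / h) `^ r * expR (h * x) * (`|A| * expR (- k * x)))).
      apply: ler_pM => //; first exact: powR_ge0.
      by apply: (le_trans H2); rewrite ler_wpM2r ?expR_ge0// ler_norm.
    have -> : - k * x = - h * x + - h * x by rewrite /h; field.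
    have e : expR (h * x) * expR (- h * x) = 1 by rewrite -expRD mulNr subrr expR0.
    rewrite expRD /C.
    have -> : (r / h) `^ r * expR (h * x) * (`|A| * (expR (- h * x) * expR (- h * x))) =
       (r / h) `^ r * `|A| * expR (- h * x) * (expR (h * x) * expR (- h * x)) by ring.
    rewrite e mulr1.
    have -> : (r / h) `^ r * `|A| / h * (h * expR (- h * x)) =
       (r / h) `^ r * `|A| * expR (- h * x) by field; rewrite gt_eqF.
    exact: lexx.
under eq_integral do rewrite EFinD.
rewrite ge0_integralD//=; last 4 first.
- by move=> x _; rewrite lee_fin mulr_ge0 ?powR_ge0// (nnm_ge0 nf).
- by apply: nnm_EFin; apply: nnmM => //; apply: nnm_cst; exact: powR_ge0.
- by move=> x _; rewrite lee_fin mulr_ge0// (nnm_ge0 nexp).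
- by apply: nnm_EFin; apply: nnmM => //; exact: nnm_cst.
have e1 : (\int[mu]_x (pos a `^ r * f x)%:E = (pos a `^ r)%:E)%E.
  under eq_integral do rewrite EFinM.
  rewrite ge0_integralZl//; last 3 first.
  - exact: nnm_EFin.
  - by move=> x _; rewrite lee_fin (nnm_ge0 nf).
  - by rewrite lee_fin powR_ge0.
  have -> : (\int[mu]_x (f x)%:E = mean f (cst 1%R))%E.
    by rewrite unlock; apply: eq_integral => x _; rewrite /= mul1r.
  by rewrite f1 mule1.
have e2 : (\int[mu]_x (C * exponential_pdf h x)%:E = C%:E)%E.
  under eq_integral do rewrite EFinM.
  rewrite ge0_integralZl//; last 2 first.
  - exact: nnm_EFin.
  - by move=> x _; rewrite lee_fin (nnm_ge0 nexp).
  by rewrite integral_exponential_pdf// ?mule1// ltW.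
by rewrite e1 e2 -EFinD ltry.
Qed.

End log_concave_densities.

(** * Moments as weights of the stop-loss transform *)

HB.lock Definition stop_loss_weight (R : realType) (r : R) (f : R -> R) : \bar R :=
  (\int[lebesgue_measure]_(y in `]0%R, +oo[) ((y `^ (r - 2))%:E * stop_loss f y))%E.
Canonical unlockable_stop_loss_weight := Unlockable stop_loss_weight.unlock.

Section moments_from_stop_loss.
Variable R : realType.
Notation mu := (@lebesgue_measure R).
Implicit Types (f g phi psi : R -> R).

Lemma integral_powR_sub (r x : R) : 1 < r -> 0 < x ->
  (\int[mu]_(y in `]0%R, x]) (y `^ (r - 2) * (x - y))%:E =
   (x `^ r / (r * (r - 1)))%:E)%E.
Proof.
move=> r1 x0.
pose G := fun y : R => (x / (r - 1)) *: (y `^ (r - 1) : R^o) - r^-1 *: (y `^ r : R^o) : R.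
have dG (y : R) : 0 < y -> is_derive y 1 G (y `^ (r - 2) * (x - y)).
  move=> y0; have i1 := is_derive1_powR (r - 1) y0; have i2 := is_derive1_powR r y0.
  have dd : is_derive (y : R^o) 1 (G : R^o -> R^o) _ :=
    is_deriveB (is_deriveZ (x / (r - 1)) i1) (is_deriveZ r^-1 i2).
  suff <- : (x / (r - 1)) *: ((r - 1) * y `^ (r - 1 - 1) : R^o) -
     r^-1 *: (r * y `^ (r - 1) : R^o) = y `^ (r - 2) * (x - y) by exact: dd.
  have -> : r - 1 - 1 = r - 2 by ring.
  have -> : y `^ (r - 1) = y * y `^ (r - 2).
    have -> : r - 2 = r - 1 - 1 by ring.
    by rewrite mulr_powRB1 ?ltW//; lra.
  by rewrite /GRing.scale/=; field; rewrite !gt_eqF//; lra.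
(* The integrand is singular at 0 when r < 2: integrate over [e n, x] and let e n tend to 0. *)
pose e (n : nat) : R := x / n.+2%:R.
have e0 n : 0 < e n by rewrite divr_gt0.
have ex n : e n < x by rewrite ltr_pdivrMr// ltr_pMr// ltr1n.
have piece n : (\int[mu]_(y in `[e n, x]) (y `^ (r - 2) * (x - y))%:E =
    (G x - G (e n))%:E)%E.
  rewrite EFinB; apply: continuous_FTC2 => //.
  - apply: derivable_within_continuous => y; rewrite in_itv/= => /andP[ey _].
    have y0 := lt_le_trans (e0 n) ey.
    apply: derivableM; last by apply: derivableB.
    by apply: ex_derive; exact: is_derive1_powR.
  - split.
    + move=> y; rewrite in_itv/= => /andP[ey _].
      exact: (@ex_derive _ _ _ _ _ _ _ (dG _ (lt_trans (e0 n) ey))).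
    + apply: cvg_at_right_filter; apply: differentiable_continuous.
      apply/derivable1_diffP; exact: (@ex_derive _ _ _ _ _ _ _ (dG _ _)).
    + apply: cvg_at_left_filter; apply: differentiable_continuous.
      apply/derivable1_diffP; exact: (@ex_derive _ _ _ _ _ _ _ (dG _ _)).
  - move=> y; rewrite in_itv/= => /andP[ey _].
    by rewrite derive1E; apply: derive_val; apply: dG; exact: lt_trans ey.
have e_cvg : e n @[n --> \oo] --> 0.
  rewrite -[X in _ --> X](mulr0 x); apply: cvgM; first exact: cvg_cst.
  apply/cvgrPdist_lt => d d0; near=> n.
  rewrite sub0r normrN ger0_norm ?invr_ge0//.
  rewrite -[ltRHS]invrK ltf_pV2 ?posrE ?invr_gt0//.
  apply: (@lt_trans _ _ n%:R); last by rewrite ltr_nat ltnS leqnSn.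
  near: n; exact: nbhs_infty_gtr.
have G_cvg : (G x - G (e n))%:E @[n --> \oo] --> (G x)%:E.
  apply: cvg_EFin; first exact: nearW.
  rewrite -[X in _ --> X]subr0; apply: cvgB; first exact: cvg_cst.
  have pw0 (a : R) : 0 < a -> (e n) `^ a @[n --> \oo] --> 0.
    move=> a0; have /cvg_at_rightP := @powR_cvg0 R a a0.
    by apply; split=> // n; exact: e0.
  rewrite (_ : 0 = (x / (r - 1)) *: (0 : R^o) - r^-1 *: (0 : R^o)); last first.
    by rewrite !scaler0 subr0.
  by apply: cvgB; apply: cvgZr; apply: pw0; lra.
have -> : x `^ r / (r * (r - 1)) = G x.
  rewrite /G /GRing.scale/=.
  have -> : x `^ r = x * x `^ (r - 1) by rewrite mulr_powRB1 ?ltW//; lra.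
  by field; rewrite !gt_eqF//; lra.
have U : `]0%R, x]%classic = \bigcup_n `[e n, x]%classic :> set R.
  apply/seteqP; split=> y /=.
    rewrite in_itv/= => /andP[y0 yx].
    have [n _ H] := (cvgr_lt 0 e_cvg _ y0).
    by exists n => //=; rewrite in_itv/= yx andbT ltW// H/=.
  by move=> [n _] /=; rewrite !in_itv/= => /andP[ey ->]; rewrite (lt_le_trans (e0 n) ey).
rewrite U; apply: cvg_unique G_cvg => //=.
rewrite (_ : (fun n => (G x - G (e n))%:E) =
    (fun n => \int[mu]_(y in `[e n, x]) (y `^ (r - 2) * (x - y))%:E)%E); last first.
  by apply/funext => n; rewrite piece.
apply: ge0_nondecreasing_set_cvg_integral => //.
- apply/nondecreasing_seqP => n; rewrite subsetEset; apply: subset_itvr; rewrite bnd_simp.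
  by rewrite ler_pM2l// lef_pV2 ?posrE// ler_nat.
- move=> n; apply/measurable_EFinP; apply: measurable_funTS.
  apply: measurable_funM; first exact: measurable_powR.
  exact: measurable_funB.
- move=> n y /=; rewrite in_itv/= => /andP[_ yx].
  by rewrite lee_fin mulr_ge0 ?powR_ge0// subr_ge0.
Unshelve. all: by end_near. Qed.

Lemma integral_powR_pos (r x : R) : 1 < r ->
  (\int[mu]_(y in `]0%R, +oo[) (y `^ (r - 2) * pos (x - y))%:E =
   (pos x `^ r / (r * (r - 1)))%:E)%E.
Proof.
move=> r1; have [x0|x0] := leP x 0.
  have -> : pos x = 0 by have [[? ->]|[? ->]] := posP x => //; lra.
  rewrite powR0 ?mul0r; last by rewrite gt_eqF//; lra.
  apply: integral0_eq => y; rewrite /= in_itv/= andbT => y0.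
  have -> : pos (x - y) = 0 :> R by have [[? ->]|[? ->]] := posP (x - y); lra.
  by rewrite mulr0.
have -> : pos x = x by have [[? ->]|[? ->]] := posP x => //; lra.
rewrite -integral_powR_sub// [LHS]integral_mkcond [RHS]integral_mkcond.
apply: eq_integral => y _; rewrite !patchE !mem_setE !in_itv/= andbT.
have [y0|//] := ltP 0 y; rewrite /=.
have [yx|xy] := leP y x.
  have -> : pos (x - y) = x - y :> R by have [[? ->]|[? ->]] := posP (x - y) => //; lra.
  by [].
have -> : pos (x - y) = 0 :> R by have [[? ->]|[? ->]] := posP (x - y) => //; lra.
by rewrite mulr0.
Qed.

(** Tonelli, applied to the double integral of y^(r - 2) (x - y)_+ f x. *)
Lemma mean_pos_powR (r : R) f : 1 < r -> nonneg_measurable f ->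
  mean f (fun x => pos x `^ r) = ((r * (r - 1))%:E * stop_loss_weight r f)%E.
Proof.
move=> r1 [mf f0]; have r0 : 0 < r * (r - 1) by rewrite mulr_gt0//; lra.
pose H (z : R * R) : R :=
    \1_(`]0%R, +oo[%classic : set R) z.1 * (z.1 `^ (r - 2)) * pos (z.2 - z.1) * f z.2.
have H0 z : 0 <= H z by rewrite /H !mulr_ge0 ?powR_ge0 ?pos_ge0.
have mH : measurable_fun [set: R * R] H.
  apply: measurable_funM; last exact: (measurableT_comp mf).
  apply: measurable_funM; last first.
    by apply: (measurableT_comp (@measurable_pos R)); apply: measurable_funB.
  apply: measurable_funM.
    by apply: (measurableT_comp (measurable_indic _)).
  by apply: (measurableT_comp (@measurable_powR R _)).
have mEH : measurable_fun [set: R * R] (EFin \o H) by exact/measurable_EFinP.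
have EH0 z : (0 <= (EFin \o H) z)%E by rewrite lee_fin.
have := fubini_tonelli (m1 := mu) (m2 := mu) (EFin \o H) mEH EH0.
have -> : (\int[mu]_y \int[mu]_x (EFin \o H) (y, x) = stop_loss_weight r f)%E.
  rewrite unlock [RHS]integral_mkcond; apply: eq_integral => y _.
  rewrite patchE; case: ifPn => [|] yD.
    rewrite /stop_loss unlock -ge0_integralZl//.
    - by apply: eq_integral => x _; rewrite /H/= indicE yD mul1r -EFinM mulrA.
    - by apply: nnm_EFin; apply: nnmM => //; exact: nnm_posB.
    - by move=> x _; rewrite lee_fin mulr_ge0// pos_ge0.
    - by rewrite lee_fin powR_ge0.
  apply: integral0_eq => x _.
  by rewrite /H/= indicE (negbTE yD) !mul0r.
have -> : (\int[mu]_x \int[mu]_y (EFin \o H) (y, x)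
    = \int[mu]_x ((r * (r - 1))^-1%:E * (pos x `^ r * f x)%:E))%E.
  apply: eq_integral => x _.
  transitivity (\int[mu]_(y in `]0%R, +oo[) ((f x)%:E * (y `^ (r - 2) * pos (x - y))%:E))%E.
    rewrite [RHS]integral_mkcond; apply: eq_integral => y _.
    rewrite patchE /H/= indicE; case: ifPn => yD; last by rewrite !mul0r.
    by rewrite mul1r -EFinM mulrC.
  rewrite ge0_integralZl//.
  - by rewrite integral_powR_pos// -!EFinM; congr EFin; field; lra.
  - apply/measurable_EFinP; apply: measurable_funTS; apply: measurable_funM;
      first exact: measurable_powR.
    by apply: nnm_measurable; exact: nnm_posBr.
  - by move=> y _; rewrite lee_fin mulr_ge0 ?powR_ge0 ?pos_ge0.
  - by rewrite lee_fin.
move=> ->; rewrite mean.unlock ge0_integralZl//.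
- by rewrite muleA -EFinM divff ?mul1e// gt_eqF.
- apply/measurable_EFinP; apply: measurable_funM => //.
  by apply: (measurableT_comp (@measurable_powR R r)); exact: measurable_pos.
- by move=> x _; rewrite lee_fin mulr_ge0// powR_ge0.
- by rewrite lee_fin invr_ge0 ltW.
Qed.

Lemma stop_loss_weight_ge0 (r : R) f : nonneg_measurable f -> (0 <= stop_loss_weight r f)%E.
Proof.
move=> nf; rewrite unlock; apply: integral_ge0 => y _; apply: mule_ge0;
    first by rewrite lee_fin powR_ge0.
by apply: mean_ge0 => //; exact: nnm_posB.
Qed.

Lemma measurable_rstop_loss f : centered_density f -> measurable_fun [set: R] (rstop_loss f).
Proof.
move=> cf; have [mf f0] := cd_nnm cf.
pose H (z : R * R) : R := pos (z.2 - z.1) * f z.2.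
have mH : measurable_fun [set: R * R] H.
  apply: measurable_funM; last exact: (measurableT_comp mf).
  by apply: (measurableT_comp (@measurable_pos R)); apply: measurable_funB.
have mEH : measurable_fun [set: R * R] (EFin \o H) by exact/measurable_EFinP.
have EH0 z : (0 <= (EFin \o H) z)%E by rewrite lee_fin /H mulr_ge0 ?pos_ge0.
apply/measurable_EFinP.
have := measurable_fun_fubini_tonelli_F (m2 := mu) (EFin \o H) mEH EH0.
by apply: eq_measurable_fun => y _; rewrite /fubini_F/= -stop_lossE// /stop_loss unlock.
Qed.

Lemma stop_loss_weightE (r : R) f : centered_density f ->
  stop_loss_weight r f = (\int[mu]_(y in `]0%R, +oo[) (y `^ (r - 2) * rstop_loss f y)%:E)%E.
Proof. by move=> cf; rewrite unlock; apply: eq_integral => y _; rewrite stop_lossE// EFinM. Qed.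

End moments_from_stop_loss.

(** * Comparison of weights under a sign pattern *)

Section single_crossing.
Variable R : realType.
Notation mu := (@lebesgue_measure R).
Implicit Types (f g : R -> R).

Lemma measurable_weight (r : R) f (D : set R) : centered_density f ->
  measurable_fun D (fun y => y `^ (r - 2) * rstop_loss f y).
Proof.
move=> cf; apply: measurable_funTS; apply: measurable_funM.
  exact: measurable_powR.
exact: measurable_rstop_loss.
Qed.

Lemma le_stop_loss_weight (r : R) f g : centered_density f -> centered_density g ->
  (forall y, 0 < y -> rstop_loss f y <= rstop_loss g y) ->
  (stop_loss_weight r f <= stop_loss_weight r g)%E.
Proof.
move=> cf cg fg; rewrite !stop_loss_weightE//; apply: ge0_le_integral => //.
- by move=> y _; rewrite lee_fin mulr_ge0 ?powR_ge0 ?rstop_loss_ge0.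
- by apply/measurable_EFinP; exact: measurable_weight.
- by apply/measurable_EFinP; exact: measurable_weight.
- move=> y; rewrite /= in_itv/= andbT => y0.
  by rewrite lee_fin ler_wpM2l ?powR_ge0// fg.
Qed.

Lemma stop_loss_weight_eq_touch (r : R) f g : centered_density f -> centered_density g ->
    stop_loss_weight r f = stop_loss_weight r g -> (stop_loss_weight r f < +oo)%E ->
  exists2 w, 0 < w & 0 <= rstop_loss f w - rstop_loss g w.
Proof.
move=> cf cg E foo; apply: contrapT => /forall2NP H.
have : (stop_loss_weight r f < stop_loss_weight r g)%E; last by rewrite E ltxx.
have mpos : mu `]0, +oo[%classic != 0%E by rewrite lebesgue_measure_itv/= ltry.
move: foo; rewrite !stop_loss_weightE//; apply: lt_integral => //.
- exact: measurable_weight.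
- exact: measurable_weight.
- move=> y; rewrite /= in_itv/= andbT => y0; split.
    by rewrite mulr_ge0 ?powR_ge0 ?rstop_loss_ge0.
  rewrite ltr_pM2l ?powR_gt0// -subr_lt0 ltNge; apply/negP => Fy.
  by case: (H y).
Qed.

(** On the positive half-line F is nonnegative before some z and negative after it, so
(y^(q - 2) - z^(q - p) y^(p - 2)) F y <= 0 for all y > 0, and the weight p integrates F to
zero. *)
Lemma stop_loss_weight_crossing (p q : R) f g :
    centered_density f -> centered_density g -> p < q ->
    convex_nonneg_on (fun=> True) (fun y => rstop_loss f y - rstop_loss g y) ->
    (exists2 u, u <= 0 & 0 <= rstop_loss f u - rstop_loss g u) ->
    stop_loss_weight p f = stop_loss_weight p g -> (stop_loss_weight p f < +oo)%E ->
  (stop_loss_weight q f <= stop_loss_weight q g)%E.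
Proof.
pose F y := rstop_loss f y - rstop_loss g y.
move=> cf cg pq iF [u u0 Fu] E foo; rewrite -!/(F _) in iF Fu.
have [w w0 Fw] := stop_loss_weight_eq_touch cf cg E foo.
pose S := [set y | 0 < y /\ 0 <= F y].
have Sw : S w by [].
have S_down y z : S z -> 0 < y -> y < z -> 0 <= F y.
  by move=> [z0 Fz] y0 yz; apply: (iF u y z) => //; apply: le_lt_trans y0.
(* If there is no such z, then F >= 0 has a vanishing integral and is zero almost everywhere. *)
have [[b bS]|noub] := pselect (has_ubound S); last first.
  have F0 y : 0 < y -> 0 <= F y.
    move=> y0; have [z Sz yz] : exists2 z, S z & y < z.
      apply: contrapT => /forall2NP nS; apply: noub; exists y => z Sz.
      by case: (nS z) => // /negP; rewrite -leNgt.
    exact: S_down Sz y0 yz.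
  have ae : {ae mu, forall y, `]0, +oo[%classic y ->
      y `^ (p - 2) * rstop_loss g y = y `^ (p - 2) * rstop_loss f y}.
    apply: le_eq_integral_ae => //.
    - exact: measurable_weight.
    - exact: measurable_weight.
    - move=> y; rewrite /= in_itv/= andbT => y0; split.
        by rewrite mulr_ge0 ?powR_ge0 ?rstop_loss_ge0.
      by rewrite ler_wpM2l ?powR_ge0// -subr_ge0; exact: F0.
    - by move: foo; rewrite E !stop_loss_weightE.
    - by move: E; rewrite !stop_loss_weightE.
  rewrite !stop_loss_weightE// le_eqVlt; apply/orP; left; apply/eqP.
  apply: ae_eq_integral => //.
  - by apply/measurable_EFinP; exact: measurable_weight.
  - by apply/measurable_EFinP; exact: measurable_weight.
  - case: ae => N [mN N0 HN]; exists N; split=> //;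
      apply: subset_trans HN => y /= Hy H; apply: Hy => y0; have := H y0.
    move: y0; rewrite in_itv/= andbT => y0.
    by move=> /(mulfI (lt0r_neq0 (powR_gt0 (p - 2) y0))) ->.
pose z := sup S.
have wz : w <= z by apply: ub_le_sup => //; exists b.
have z0 : 0 < z by apply: lt_le_trans wz.
have F_below y : 0 < y -> y < z -> 0 <= F y.
  by move=> y0 /(sup_gt (ex_intro _ w Sw))[t St yt]; exact: S_down St y0 yt.
have F_above y : z < y -> F y < 0.
  move=> zy; rewrite ltNge; apply/negP => Fy.
  have : y <= z; last by rewrite leNgt zy.
  by apply: ub_le_sup; [exists b|split=> //; exact: lt_trans zy].
pose k := z `^ (q - p).
have k0 : 0 <= k by exact: powR_ge0.
(* Moving the subtracted terms across keeps all integrands nonnegative. *)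
have key : (stop_loss_weight q f + k%:E * stop_loss_weight p g <=
            stop_loss_weight q g + k%:E * stop_loss_weight p f)%E.
  have W (r : R) h : centered_density h -> 
      [/\ measurable_fun (`]0, +oo[%classic : set R) (fun y => (y `^ (r - 2) * rstop_loss h y)%:E)
        & forall y, (0 <= (y `^ (r - 2) * rstop_loss h y)%:E)%E].
    move=> ch; split; first by apply/measurable_EFinP; exact: measurable_weight.
    by move=> y; rewrite lee_fin mulr_ge0 ?powR_ge0 ?rstop_loss_ge0.
  have [mqf qf0] := W q f cf; have [mqg qg0] := W q g cg.
  have [mpf pf0] := W p f cf; have [mpg pg0] := W p g cg.
  have mZ (h : R -> \bar R) : measurable_fun (`]0, +oo[%classic : set R) h ->
    measurable_fun (`]0, +oo[%classic : set R)
        (fun y => k%:E * h y)%E by move=> mh; exact: emeasurable_funM.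
  rewrite !stop_loss_weightE// -!ge0_integralZl// -!ge0_integralD//; last 4 first.
  - by move=> y _; rewrite mule_ge0// lee_fin.
  - exact: mZ.
  - by move=> y _; rewrite mule_ge0// lee_fin.
  - exact: mZ.
  apply: ge0_le_integral => //.
  - by move=> y _; rewrite adde_ge0// mule_ge0// lee_fin.
  - by apply: emeasurable_funD => //; exact: mZ.
  - by apply: emeasurable_funD => //; exact: mZ.
  move=> y; rewrite /= in_itv/= andbT => y0.
  rewrite -!EFinM -!EFinD lee_fin.
  have -> : y `^ (q - 2) = y `^ (q - p) * y `^ (p - 2).
    rewrite -powRD; first by congr (_ `^ _); ring.
    by rewrite (gt_eqF y0) implybT.
  suff : (y `^ (q - p) - k) * F y <= 0.
    have := powR_ge0 y (p - 2); rewrite /F; set a := y `^ (p - 2) => a0 H.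
    have := mulr_ge0_le0 a0 H; lra.
  have qp : 0 <= q - p by lra.
  have [yz|] := ltP y z.
    apply: mulr_le0_ge0; last exact: F_below.
    by rewrite subr_le0; apply: ge0_ler_powR; rewrite ?nnegrE// ltW.
  rewrite le_eqVlt => /orP[/eqP zy|zy]; first by rewrite /k zy subrr mul0r.
  apply: mulr_ge0_le0; last by apply: ltW; exact: F_above.
  by rewrite subr_ge0; apply: ge0_ler_powR; rewrite ?nnegrE// ltW.
move: key; rewrite -E.
have : (k%:E * stop_loss_weight p f)%E \is a fin_num.
  rewrite fin_numM// ge0_fin_numE//; apply: stop_loss_weight_ge0; exact: cd_nnm.
by move=> /leeD2rE ->.
Qed.

(** If the positive weight of f were larger, F would be positive at some w > 0, hence
nonnegative on the whole of (-oo, w); the negative weight of f would then be at least that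
of g, and the total weight of f strictly larger. *)
Lemma stop_loss_weight_endpoint (p m0 : R) f g :
    centered_density f -> centered_density g ->
    convex_nonneg_on (fun=> True) (fun y => rstop_loss f y - rstop_loss g y) ->
    (forall u, u < m0 -> 0 <= rstop_loss f u - rstop_loss g u) ->
    (stop_loss_weight p (flip f) < +oo)%E ->
    (stop_loss_weight p f + stop_loss_weight p (flip f) =
     stop_loss_weight p g + stop_loss_weight p (flip g))%E ->
  (stop_loss_weight p f <= stop_loss_weight p g)%E.
Proof.
move=> cf cg iF F0 fin1 E; rewrite leNgt; apply/negP => gf.
have [w w0 Fw] : exists2 w, 0 < w & 0 < rstop_loss f w - rstop_loss g w.
  apply: contrapT => /forall2NP H; move: gf; rewrite ltNge => /negP; apply.
  apply: le_stop_loss_weight => // y y0; rewrite -subr_le0 leNgt; apply/negP => Fy.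
  by case: (H y).
have left_ge0 y : y < 0 -> 0 <= rstop_loss f y - rstop_loss g y.
  move=> y0; have [/F0//|m0y] := ltP y m0.
  apply: (iF (m0 - 1) y w) => //; [lra|lra|by apply: F0; lra|exact: ltW].
have : (stop_loss_weight p (flip g) <= stop_loss_weight p (flip f))%E.
  apply: le_stop_loss_weight; [exact: flip_centered|exact: flip_centered|].
  move=> y y0; rewrite !rstop_loss_flip//; have := left_ge0 (- y); lra.
have nf := flip_centered cf; have ng := flip_centered cg.
move=> flip_le.
have flip_fin : stop_loss_weight p (flip g) \is a fin_num.
  rewrite ge0_fin_numE ?(le_lt_trans flip_le)//.
  by apply: stop_loss_weight_ge0; exact: cd_nnm.
by have := lte_leD flip_fin gf flip_le; rewrite E ltxx.
Qed.

End single_crossing.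

(** * Comparison of moments *)

Section moment_comparison.
Variable R : realType.
Implicit Types (f g : R -> R).

Definition pos_moment (r : R) f : \bar R := mean f (fun x => pos x `^ r).

Lemma pos_momentE (r : R) f : 1 < r -> nonneg_measurable f ->
  pos_moment r f = ((r * (r - 1))%:E * stop_loss_weight r f)%E.
Proof. exact: mean_pos_powR. Qed.

Let coef_gt0 (r : R) : 1 < r -> 0 < r * (r - 1).
Proof. by move=> r1; rewrite mulr_gt0//; lra. Qed.

Lemma le_pos_moment (r : R) f g : 1 < r -> nonneg_measurable f -> nonneg_measurable g ->
  (pos_moment r f <= pos_moment r g)%E = (stop_loss_weight r f <= stop_loss_weight r g)%E.
Proof.
by move=> r1 nf ng; rewrite !pos_momentE// lee_pmul2l// lte_fin coef_gt0.
Qed.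

Lemma eq_pos_moment (r : R) f g : 1 < r -> nonneg_measurable f -> nonneg_measurable g ->
  pos_moment r f = pos_moment r g -> stop_loss_weight r f = stop_loss_weight r g.
Proof.
move=> r1 nf ng E; apply/le_anti; rewrite -!le_pos_moment// E lexx.
by [].
Qed.

Lemma lty_pos_moment (r : R) f : 1 < r -> nonneg_measurable f ->
  (pos_moment r f < +oo)%E -> (stop_loss_weight r f < +oo)%E.
Proof.
move=> r1 nf; rewrite pos_momentE//.
have := stop_loss_weight_ge0 r nf; case: (stop_loss_weight r f) => [a _ _|//|//].
  exact: ltry.
by rewrite gt0_muley// lte_fin coef_gt0.
Qed.

Section against_two_sided_exponential.
Variables (f g : R -> R) (m : R).
Hypotheses (cf : centered_density f) (cg : centered_density g).
Hypotheses (lf : log_concave_fun f) (tg : two_sided_exponential g m).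

Lemma stop_loss_diff_convex_nonneg :
  convex_nonneg_on (fun=> True) (fun y => rstop_loss f y - rstop_loss g y).
Proof.
have [Dl Dr] := log_concave_tse (nnm_ge0 (cd_nnm cf)) lf tg.
exact: sap_convex_nonneg (stop_loss_pattern cf cg) Dl Dr.
Qed.

(** Equality of the negative moments provides a point u <= 0 with F u >= 0, which
[stop_loss_weight_crossing] needs on the positive side, and conversely. *)
Lemma pos_moment_comparison (p q : R) : 1 < p -> p < q ->
    pos_moment p f = pos_moment p g -> pos_moment p (flip f) = pos_moment p (flip g) ->
    (pos_moment p g < +oo)%E -> (pos_moment p (flip g) < +oo)%E ->
  (pos_moment q f <= pos_moment q g)%E /\
  (pos_moment q (flip f) <= pos_moment q (flip g))%E.
Proof.
move=> p1 pq E1 E2 fin1 fin2.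
have nf := cd_nnm cf; have ng := cd_nnm cg.
have cf' := flip_centered cf; have cg' := flip_centered cg.
have nf' := cd_nnm cf'; have ng' := cd_nnm cg'.
have q1 : 1 < q by lra.
rewrite !le_pos_moment//.
have {}fin1 := lty_pos_moment p1 ng fin1; have {}fin2 := lty_pos_moment p1 ng' fin2.
have {}E1 := eq_pos_moment p1 nf ng E1; have {}E2 := eq_pos_moment p1 nf' ng' E2.
have flipF y : rstop_loss (flip f) y - rstop_loss (flip g) y =
               rstop_loss f (- y) - rstop_loss g (- y).
  by rewrite !rstop_loss_flip//; ring.
have iF := stop_loss_diff_convex_nonneg.
have iF' : convex_nonneg_on (fun=> True)
    (fun y => rstop_loss (flip f) y - rstop_loss (flip g) y).
  move=> u v w _ _ uv vw; rewrite !flipF => Fu Fw.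
  by apply: (iF (- w) (- v) (- u)) => //; lra.
have [w w0 Fw] : exists2 w, 0 < w & 0 <= rstop_loss f w - rstop_loss g w.
  by apply: (stop_loss_weight_eq_touch cf cg E1); rewrite E1.
have [u u0 Fu] : exists2 u, 0 < u &
    0 <= rstop_loss (flip f) u - rstop_loss (flip g) u.
  by apply: (stop_loss_weight_eq_touch cf' cg' E2); rewrite E2.
split.
- apply: (stop_loss_weight_crossing cf cg pq iF _ E1); last by rewrite E1.
  by exists (- u); [lra|rewrite -flipF].
- apply: (stop_loss_weight_crossing cf' cg' pq iF' _ E2); last by rewrite E2.
  by exists (- w); [lra|rewrite flipF opprK].
Qed.

Lemma pos_moment_endpoint (p : R) : 1 < p -> (forall x, x < m -> g x = 0) ->
    (pos_moment p (flip f) < +oo)%E ->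
    (pos_moment p f + pos_moment p (flip f) =
     pos_moment p g + pos_moment p (flip g))%E ->
  (pos_moment p f <= pos_moment p g)%E.
Proof.
move=> p1 g0 fin E.
have nf := cd_nnm cf; have ng := cd_nnm cg.
have nf' := flip_nnm nf; have ng' := flip_nnm ng.
have {}fin := lty_pos_moment p1 nf' fin.
rewrite le_pos_moment//.
apply: (stop_loss_weight_endpoint (m0 := m)) => //.
- exact: stop_loss_diff_convex_nonneg.
- move=> u um; apply: (sap_left_ge0 (stop_loss_pattern cf cg)) => t tu.
  by rewrite g0 ?subr0 ?(nnm_ge0 nf)//; exact: lt_trans um.
- move: E; rewrite !pos_momentE// -!ge0_muleDr ?stop_loss_weight_ge0//.
  have c0 := coef_gt0 p1; move=> /(congr1 (fun x => ((p * (p - 1))^-1%:E * x)%E)).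
  by rewrite !muleA -!EFinM mulVf ?gt_eqF// !mul1e.
Qed.

End against_two_sided_exponential.

Lemma abs_powR_split (r x : R) : 0 < r -> `|x| `^ r = pos x `^ r + pos (- x) `^ r.
Proof.
move=> r0; have r00 : r != 0 by rewrite gt_eqF.
have [[x0 ->]|[x0 ->]] := posP x; have [[y0 ->]|[y0 ->]] := posP (- x).
- have -> : x = 0 by lra.
  by rewrite normr0 oppr0 powR0// addr0.
- by rewrite ger0_norm// powR0// addr0.
- by rewrite ltr0_norm// powR0// add0r.
- by exfalso; lra.
Qed.

Lemma mean_abs_powR (r : R) f : 0 < r -> nonneg_measurable f ->
  mean f (fun x => `|x| `^ r) = (pos_moment r f + pos_moment r (flip f))%E.
Proof.
move=> r0 nf.
have npos : nonneg_measurable (fun x : R => pos x `^ r).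
  split=> [|x]; last exact: powR_ge0.
  by apply: (measurableT_comp (@measurable_powR R r)); exact: measurable_pos.
rewrite /pos_moment mean_flip// -meanD//; last exact: (flip_nnm npos).
by apply: eq_mean => x; exact: abs_powR_split.
Qed.

(** Otherwise f would vanish almost everywhere outside 0. *)
Lemma mean_abs_powR_gt0 (r : R) f : 0 < r -> nonneg_measurable f ->
  mean f (cst 1) = 1%E -> (0 < mean f (fun x => `|x| `^ r)%R)%E.
Proof.
move=> r0 nf f1.
have nabs : nonneg_measurable (fun x : R => `|x| `^ r).
  split=> [|x]; last exact: powR_ge0.
  apply: (measurableT_comp (@measurable_powR R r)).
  exact: (measurableT_comp (@normr_measurable R _)).
rewrite lt_neqAle mean_ge0// andbT; apply/eqP => E.
have nM := nnmM nabs nf.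
have : (\int[lebesgue_measure]_x `|(`|x| `^ r * f x)%R%:E| = 0)%E.
  by rewrite E unlock; apply: eq_integral => x _; rewrite gee0_abs// lee_fin (nnm_ge0 nM).
have mM : measurable_fun setT (fun x : measurableTypeR R => (`|x| `^ r * f x)%:E).
  exact: nnm_EFin nM.
move=> /((ae_eq_integral_abs (@lebesgue_measure R) measurableT mM).1) [N [mN N0 HN]].
have : mean f (cst 1) = 0%E; last by rewrite f1 => /eqP; rewrite onee_eq0.
rewrite unlock (ge0_ae_eq_integral _ (g := cst 0%E)) ?integral0//.
- by apply: nnm_EFin; apply: nnmM => //; exact: nnm_cst.
- by move=> x _; rewrite lee_fin mul1r (nnm_ge0 nf).
exists (N `|` [set 0]); split.
- by apply: measurableU.
- rewrite measureU0//; exact: lebesgue_measure_set1.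
- move=> x /= /not_implyP[_ fx]; have [->|x0] := eqVneq x 0; [by right|left].
  apply: HN => /= /(_ Logic.I) [] /eqP; rewrite mulf_eq0 powR_eq0 normr_eq0 (negbTE x0)/=.
  by move=> /eqP fx0; apply: fx; rewrite fx0 mulr0.
Qed.


End moment_comparison.

(** * Random variables with a density *)

Lemma norm_pos (R : realType) (x : R) : `|x| = pos x + pos (- x).
Proof.
have [[h ->]|[h ->]] := posP x; have [[k ->]|[k ->]] := posP (- x).
- have -> : x = 0 by lra.
  by rewrite normr0; lra.
- by rewrite ger0_norm//; lra.
- by rewrite ltr0_norm//; lra.
- by exfalso; lra.
Qed.

Section densities_of_random_variables.
Variable R : realType.
Notation mu := (@lebesgue_measure R).
Local Open Scope ereal_scope.
Import HBNNSimple.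

Lemma integral_against_density (nu : {measure set R -> \bar R}) (f : R -> R) :
    nonneg_measurable f ->
    (forall A : set R, measurable A -> nu A = \int[mu]_(x in A) (f x)%:E) ->
  forall h : R -> \bar R, measurable_fun [set: R] h -> (forall x, 0 <= h x) ->
    \int[nu]_x h x = \int[mu]_x (h x * (f x)%:E).
Proof.
move=> [mf f0] nuE h mh h0; pose h_ := nnsfun_approx measurableT mh.
have h_cvg x : (EFin \o h_^~ x) n @[n --> \oo] --> h x by exact: cvg_nnsfun_approx.
have nd x n m : (n <= m)%N -> (h_ n x <= h_ m x)%R.
  by move=> nm; exact/lefP/nd_nnsfun_approx.
have mEf : measurable_fun [set: R] (EFin \o f) by exact/measurable_EFinP.
have mh_ n : measurable_fun [set: R] (fun x => (h_ n x)%:E) by apply/measurable_EFinP.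
transitivity (limn (fun n => \int[nu]_x (h_ n x)%:E)).
  rewrite -monotone_convergence//.
  - by apply: eq_integral => x _; apply/esym/cvg_lim => //; exact: h_cvg.
  - by move=> n x _; rewrite lee_fin.
  - by move=> x _ n m nm; rewrite lee_fin nd.
transitivity (limn (fun n => \int[mu]_x ((h_ n x)%:E * (f x)%:E))); last first.
  rewrite -monotone_convergence//.
  - apply: eq_integral => x _; apply/cvg_lim => //.
    by apply: cvgeZr => //; exact: h_cvg.
  - move=> n; apply: emeasurable_funM => //.
    exact: mh_.
  - by move=> n x _; rewrite mule_ge0 ?lee_fin.
  - by move=> x _ n m nm; rewrite lee_wpmul2r ?lee_fin ?nd.
congr (limn _); apply/funext => n.
have mfib (r : R) : measurable (h_ n @^-1` [set r]) by [].
transitivity (\sum_(k \in range (h_ n))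
    \int[mu]_x (k * \1_(h_ n @^-1` [set k]) x * f x)%:E).
  rewrite integralT_nnsfun sintegralE.
  apply: eq_fsbigr => r rr.
  rewrite nuE// integral_mkcond.
  have r0 : (0 <= r)%R by move: rr; rewrite inE => -[x _ <-].
  rewrite -ge0_integralZl//.
  - apply: eq_integral => x _; rewrite patchE indicE.
    by case: ifPn => _; rewrite ?mulr1 ?mulr0 ?mul0r ?mule0// EFinM.
  - exact: ((measurable_restrictT (EFin \o f) (mfib r)).1 (measurable_funTS mEf)).
  - by move=> x _; rewrite patchE; case: ifPn => // _; rewrite lee_fin.
rewrite -ge0_integral_fsum//.
- apply: eq_integral => x _; rewrite fsumEFin// -EFinM; congr EFin.
  rewrite [in RHS]fimfunE !fsbig_finite//= mulr_suml.
  by [].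
- move=> r; apply/measurable_EFinP.
  have : measurable_fun [set: R] (fun x : R => r * \1_(h_ n @^-1` [set r]) x * f x)%R.
    by apply: measurable_funM => //; apply: measurable_funM => //.
  exact.
- move=> r x _; rewrite lee_fin mulr_ge0//.
  by have := nnfun_muleindic_ge0 (h_ n) r x; rewrite lee_fin.
Qed.

Lemma is_density_nnm d (T : measurableType d) (P : probability T R)
  (X : {RV P >-> R}) (f : R -> R) : is_density X f -> nonneg_measurable f.
Proof. by move=> [mf f0 _]. Qed.

Lemma expectation_density d (T : measurableType d) (P : probability T R)
    (X : {RV P >-> R}) (f phi : R -> R) : is_density X f ->
  nonneg_measurable phi -> \int[P]_w (phi (X w))%:E = mean f phi.
Proof.
move=> df np; have [mf f0 XE] := df.
rewrite -(ge0_integral_distribution (P := P) X (f := EFin \o phi)); last 2 first.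
- by apply/measurable_EFinP; exact: nnm_measurable np.
- by move=> y; rewrite lee_fin (nnm_ge0 np).
rewrite unlock (@integral_against_density _ f) //.
- by apply/measurable_EFinP; exact: nnm_measurable np.
- by move=> y; rewrite lee_fin (nnm_ge0 np).
Qed.

Lemma is_density_mass d (T : measurableType d) (P : probability T R)
    (X : {RV P >-> R}) (f : R -> R) : is_density X f -> mean f (cst 1%R) = 1.
Proof.
move=> df; rewrite -(expectation_density df); last exact: nnm_cst.
by rewrite (integral_cst P measurableT 1%:E) mul1e; exact: probability_setT.
Qed.

Lemma is_density_centered d (T : measurableType d) (P : probability T R)
    (X : {RV P >-> R}) (f : R -> R) : is_density X f -> centered X ->
  centered_density f.
Proof.
move=> df; rewrite /centered unlock integralE.
have E1 : \int[P]_w (EFin \o X)^\+ w = mean f pos.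
  rewrite -(expectation_density df); last exact: nnm_pos_id.
  by apply: eq_integral => w _; rewrite funeposE /pos/= -EFin_max.
have E2 : \int[P]_w (EFin \o X)^\- w = mean f (fun x => pos (- x)).
  rewrite -(expectation_density df); last exact: nnm_posN.
  by apply: eq_integral => w _; rewrite funenegE /pos/= -EFin_max.
rewrite E1 E2 => E0.
have nf := is_density_nnm df.
have p0 : 0 <= mean f pos by apply: mean_ge0 => //; exact: nnm_pos_id.
have m0 : 0 <= mean f (fun x => pos (- x)) by apply: mean_ge0 => //; exact: nnm_posN.
suff [H1 H2] : mean f pos < +oo /\ mean f (fun x => pos (- x)) = mean f pos.
  by split => //; exact: is_density_mass df.
move: E0 p0 m0; case: (mean f pos) => [a||]; case: (mean f (fun x => pos (- x))) => [b||] //=.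
by move=> [E0] _ _; split; [exact: ltry|congr EFin; lra].
Qed.

Lemma centered_density_expectation d (T : measurableType d) (P : probability T R)
    (X : {RV P >-> R}) (f : R -> R) : is_density X f -> centered_density f ->
  P.-integrable [set: T] (EFin \o X) /\ centered X.
Proof.
move=> df cf; have nf := cd_nnm cf.
have E1 : \int[P]_w (EFin \o X)^\+ w = mean f pos.
  rewrite -(expectation_density df); last exact: nnm_pos_id.
  by apply: eq_integral => w _; rewrite funeposE /pos/= -EFin_max.
have E2 : \int[P]_w (EFin \o X)^\- w = mean f (fun x => pos (- x)).
  rewrite -(expectation_density df); last exact: nnm_posN.
  by apply: eq_integral => w _; rewrite funenegE /pos/= -EFin_max.
have pf : mean f pos \is a fin_num.
  by rewrite ge0_fin_numE ?(cd_fin cf)//; apply: mean_ge0 => //; exact: nnm_pos_id.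
split; last by rewrite /centered unlock integralE E1 E2 (cd_balance cf) subee.
apply/integrableP; split; first exact/measurable_EFinP.
have -> : \int[P]_w `|(EFin \o X) w| = mean f (fun x => pos x + pos (- x))%R.
  rewrite -(expectation_density df); last first.
    by apply: nnmD; [exact: nnm_pos_id|exact: nnm_posN].
  by apply: eq_integral => w _; rewrite /= norm_pos.
rewrite meanD//; last 2 first.
- exact: nnm_pos_id.
- exact: nnm_posN.
by rewrite (cd_balance cf) lte_add_pinfty ?(cd_fin cf).
Qed.

End densities_of_random_variables.

(** * Affine change of variables *)

Section affine_change_of_variables.
Variable R : realType.
Notation mu := (@lebesgue_measure R).
Local Open Scope ereal_scope.

Lemma integral_affine (a c : R) (h : R -> \bar R) : (0 < a)%R ->
    measurable_fun [set: R] h -> (forall x, 0 <= h x) ->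
  \int[mu]_x h (a * x + c)%R = (a^-1)%:E * \int[mu]_x h x.
Proof.
move=> a0 mh h0.
pose T : measurableTypeR R -> measurableTypeR R := (fun x : R => a * x + c)%R.
have mT : measurable_fun setT T.
  by apply: measurable_funD => //; exact: measurable_funM.
have H := @ge0_integral_pushforward _ _ _ _ R _ mT mu _ _ measurableT mh (fun x _ => h0 x).
set nu := (X in \int[X]_(y in _) _ = _) in H.
have main (n : {measure set (measurableTypeR R) -> \bar R}) :
    (forall u v : R, mu `]u, v]%classic = a%:E * n `]u, v]%classic) ->
    \int[mu]_x h x = a%:E * \int[n]_x h x.
  move=> nE; rewrite -[a%:E]/((NngNum (ltW a0))%:num%:E) -ge0_integral_mscale//.
  apply: eq_measure_integral => A mA _.
  by apply: (@lebesgue_measure_unique R) mA => _ [[u v]] _ <-; exact: nE.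
move: H; rewrite preimage_setT => H.
transitivity (\int[nu]_x h x); first by rewrite H.
transitivity (a^-1%:E * (a%:E * \int[nu]_x h x)).
  by rewrite muleA -EFinM mulVf ?gt_eqF// mul1e.
congr (_ * _).
apply/esym/main => u v.
change (mu `]u, v]%classic = a%:E * mu (T @^-1` `]u, v]%classic)).
have -> : T @^-1` `]u, v]%classic = `]((u - c) / a)%R, ((v - c) / a)%R]%classic.
  apply/seteqP; split=> x /=; rewrite /T !in_itv/= ltr_pdivrMr// ler_pdivlMr//;
    by rewrite [(x * a)%R]mulrC ltrBlDr lerBrDr.
rewrite !lebesgue_measure_itv/= !lte_fin ltr_pM2r ?invr_gt0// ltrD2r.
by case: ifPn => uv; rewrite ?mule0// -!EFinD -EFinM; congr EFin; field; rewrite gt_eqF.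
Qed.

End affine_change_of_variables.

(** * The centered exponential density *)

Section centered_exponential.
Variable R : realType.
Notation mu := (@lebesgue_measure R).

Lemma gamma_pdfE (x : R) : gamma_pdf x = if -1 <= x then expR (- (x + 1)) else 0.
Proof. by rewrite /gamma_pdf patchE mem_setE in_itv/= andbT. Qed.

Lemma gamma_pdf_nnm : nonneg_measurable (@gamma_pdf R).
Proof.
split=> [|x]; last by rewrite gamma_pdfE; case: ifP => // _; exact: expR_ge0.
apply/(measurable_restrictT _ _).1 => //; apply: measurable_funTS.
apply: (measurableT_comp (@measurable_expR R)).
by apply: (measurableT_comp (@oppr_measurable R _)); exact: measurable_funD.
Qed.

Lemma gamma_pdf_log_concave : log_concave_fun (@gamma_pdf R).
Proof.
move=> u v w uv vw; rewrite !gamma_pdfE.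
case: (leP (-1) u) => [u1|]; last by rewrite ltxx.
have -> : -1 <= v by lra.
have -> : -1 <= w by lra.
by move=> _ _; split; [exact: expR_gt0|rewrite !expRK; lra].
Qed.

(** A multiple of the translate by y0 of the exponential density with rate c. *)
Lemma integral_exp_tail (c y0 K : R) : 0 < c ->
  (\int[mu]_y (if y0 <= y then expR (K - c * y) else 0)%:E =
   (expR (K - c * y0) / c)%:E)%E.
Proof.
move=> c0; pose D := expR (K - c * y0) / c.
have D0 : 0 <= D by rewrite /D divr_ge0 ?expR_ge0 ?ltW.
have mexp : measurable_fun [set: R] (exponential_pdf c) by exact: measurable_exponential_pdf.
have exp0 x : 0 <= exponential_pdf c x by apply: exponential_pdf_ge0; exact: ltW.
transitivity (\int[mu]_y (D%:E * (exponential_pdf c (1 * y + - y0))%:E))%E.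
  apply: eq_integral => y _; rewrite -EFinM /exponential_pdf patchE mem_setE in_itv/= andbT.
  rewrite mul1r subr_ge0; case: ifPn => _; last by rewrite mulr0.
  congr EFin; rewrite /D.
  have -> : expR (K - c * y0) / c * (c * expR (- c * (y - y0))) =
      expR (K - c * y0) * expR (- c * (y - y0)) by field; rewrite gt_eqF.
  by rewrite -expRD; congr expR; ring.
rewrite ge0_integralZl//; last 2 first.
- apply/measurable_EFinP; apply: (measurableT_comp mexp).
  by apply: measurable_funD => //; exact: measurable_funM.
- by move=> y _; rewrite lee_fin.
rewrite (@integral_affine _ 1 (- y0) (fun x => (exponential_pdf c x)%:E))//.
- by rewrite integral_exponential_pdf// ?invr1 ?mule1// ltW.
- exact/measurable_EFinP.
Qed.

Lemma integral_id_expN : (\int[mu]_(t in `[0%R, +oo[) (t * expR (- t))%:E = 1%:E)%E.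
Proof.
pose F := fun t : R => - ((t + 1) * expR (- t)).
have dF t : is_derive (t : R^o) 1 (F : R^o -> R^o) (t * expR (- t)).
  have h1 : is_derive (t : R^o) 1 (fun t : R^o => t + 1 : R^o) 1.
    by apply: is_derive_eq; rewrite addr0.
  have h2 : is_derive (t : R^o) 1 (fun t : R^o => expR (- t) : R^o) (- expR (- t)).
    by apply: is_derive_eq; rewrite /GRing.scale/=; ring.
  have := is_deriveN (is_deriveM h1 h2).
  by move=> h; apply: (is_derive_eq h); rewrite /GRing.scale/=; ring.
have cF : continuous F.
  by move=> t; apply: differentiable_continuous; apply/derivable1_diffP;
      exact: (@ex_derive _ _ _ _ _ _ _ (dF t)).
have cexp : continuous (fun t : R => expR (- t)).
  by move=> t; apply: continuous_comp; [exact: opp_continuous|exact: continuous_expR].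
have -> : 1%:E = (0%:E - (F 0)%:E)%E.
  by rewrite -EFinB; congr EFin; rewrite /F oppr0 expR0; ring.
apply: ge0_continuous_FTC2y.
- by move=> t t0; rewrite mulr_ge0 ?expR_ge0.
- have cf : continuous (fun t : R => t * expR (- t)).
    by move=> t; apply: cvgM; [exact: cvg_id|exact: cexp].
  exact: continuous_subspaceT cf.
- rewrite -[X in _ --> X]oppr0; apply: cvgN.
  (* t + 1 <= 2 * expR (t / 2) *)
  apply: (@squeeze_cvgr _ _ _ _ (cst 0) (fun t => 2 * expR (- (2^-1 * t)))).
  + near=> t; have t0 : 0 <= t by near: t; exact: nbhs_pinfty_ge.
    rewrite mulr_ge0 ?expR_ge0//=; last lra.
    have -> : - t = - (2^-1 * t) + - (2^-1 * t) by field.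
    rewrite expRD mulrA ler_wpM2r ?expR_ge0//.
    have : 1 + 2^-1 * t <= expR (2^-1 * t) by exact: expR_ge1Dx.
    rewrite expRN => H; have e0 := expR_gt0 (2^-1 * t).
    by rewrite ler_pdivrMr//; lra.
  + exact: cvg_cst.
  + rewrite -[X in _ --> X](mulr0 2); apply: cvgM; first exact: cvg_cst.
    apply: (@cvg_comp _ _ _ (fun t => 2^-1 * t) (fun t => expR (- t)) _ (pinfty_nbhs R)).
      by apply: gt0_cvgMry => //; exact: cvg_id.
    exact: cvgr_expR.
- by move=> t _; exact: (@ex_derive _ _ _ _ _ _ _ (dF t)).
- by apply: cvg_at_right_filter; exact: cF.
- by move=> t _; rewrite derive1E; exact: (@derive_val _ _ _ _ _ _ _ (dF t)).
Unshelve. all: by end_near. Qed.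

(** E (Gamma + 1) is the integral of t exp (- t), and (x + 1)_+ + x_- = x_+ + 1 on the
support x >= -1. *)
Lemma gamma_pdf_centered : centered_density (@gamma_pdf R).
Proof.
have ng := gamma_pdf_nnm.
have mass : mean (@gamma_pdf R) (cst 1) = 1%E.
  rewrite unlock -[RHS](_ : (expR ((- 1) - 1 * (- 1)) / 1)%:E = _); last first.
    by rewrite mulrN1 opprK addNr expR0 divr1.
  rewrite -integral_exp_tail//; apply: eq_integral => x _.
  rewrite mul1r gamma_pdfE; case: ifP => // _; congr (expR _)%:E; ring.
have n1 : nonneg_measurable (fun x : R => pos (x + 1)).
  by apply: nnm_pos; exact: measurable_funD.
have nI := @nnm_pos_id R; have nN := @nnm_posN R.
have m1 : mean (@gamma_pdf R) (fun x => pos (x + 1)) = 1%E.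
  pose h (t : R) : \bar R := (if 0 <= t then t * expR (- t) else 0)%:E.
  transitivity (\int[mu]_x h (1 * x + 1)%R)%E.
    rewrite unlock; apply: eq_integral => x _; rewrite /h mul1r gamma_pdfE.
    have -> : (-1 <= x) = (0 <= x + 1) by rewrite -lerBlDr sub0r.
    case: ifP => x1; last by rewrite mulr0.
    have -> : pos (x + 1) = x + 1 :> R by have [[? ->]|[? ->]] := posP (x + 1) => //; lra.
    by [].
  rewrite integral_affine//.
  - rewrite invr1 mul1e -integral_id_expN [RHS]integral_mkcond.
    by apply: eq_integral => t _; rewrite patchE mem_setE in_itv/= andbT /h; case: ifP.
  - apply/measurable_EFinP; apply: measurable_fun_ifT => //.
      exact: measurable_fun_ler.
    apply: measurable_funM => //; apply: (measurableT_comp (@measurable_expR R)).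
    exact: oppr_measurable.
  - by move=> t; rewrite /h lee_fin; case: ifP => // t0; rewrite mulr_ge0 ?expR_ge0.
have fin : (mean (@gamma_pdf R) pos < +oo)%E.
  apply: (@le_lt_trans _ _ (mean (@gamma_pdf R) (fun x => pos (x + 1)))); last by rewrite m1 ltry.
  apply: le_mean => // x.
  by have [[? ->]|[? ->]] := posP x; have [[? ->]|[? ->]] := posP (x + 1); lra.
split => //.
have nc : nonneg_measurable (cst (1 : R)) by exact: nnm_cst.
have : (mean (@gamma_pdf R) (fun x => pos (x + 1)%R + pos (- x))%R =
        mean (@gamma_pdf R) (fun x => pos x + cst 1 x)%R)%E.
  rewrite unlock; apply: eq_integral => x _; congr EFin; rewrite gamma_pdfE.
  case: ifP => x1; last by rewrite !mulr0.
  congr (_ * _); have [[? ->]|[? ->]] := posP (x + 1); have [[? ->]|[? ->]] := posP x;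
  by have [[? ->]|[? ->]] := posP (- x); rewrite /=; lra.
rewrite !meanD// m1 mass.
move: fin (mean_ge0 ng nI); case: (mean _ pos) => //= a _ _.
by case: (mean _ _) => //= b [H]; congr EFin; lra.
Qed.

End centered_exponential.

(** * The density of a Gamma - b Gamma' *)

Section asymmetric_laplace.
Variable R : realType.
Notation mu := (@lebesgue_measure R).

Lemma distribution_indic d (T : measurableType d) (P : probability T R)
    (Y : {RV P >-> R}) (A : set R) : measurable A ->
  distribution P Y A = (\int[P]_w (\1_A (Y w))%:E)%E.
Proof.
move=> mA; rewrite (integral_indic P measurableT (A := Y @^-1` A)) ?setIT//.
by rewrite -[X in measurable X]setTI; exact: measurable_funP.
Qed.

Lemma expectation_independent d (T : measurableType d) (P : probability T R)
    (X Y : {RV P >-> R}) (f g : R -> R) (phi : R * R -> R) :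
    is_density X f -> is_density Y g -> independent_RV2 X Y ->
    measurable_fun [set: R * R] phi -> (forall z, 0 <= phi z) ->
  (\int[P]_w (phi (X w, Y w))%:E =
   \int[mu]_y (\int[mu]_x (phi (x, y) * f x)%:E * (g y)%:E))%E.
Proof.
move=> df dg XY mphi phi0; have [mf f0 XE] := df; have [mg g0 YE] := dg.
pose XYw w := (X w, Y w).
have mXY : measurable_fun [set: T] XYw by exact: measurable_fun_pair.
have mE : measurable_fun [set: R * R] (EFin \o phi) by exact/measurable_EFinP.
have E0 z : (0 <= (EFin \o phi) z)%E by rewrite lee_fin.
have H := @ge0_integral_pushforward _ _ _ _ R _ mXY P _ _ measurableT mE (fun z _ => E0 z).
transitivity (\int[distribution P X \x distribution P Y]_z (EFin \o phi) z)%E.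
  rewrite preimage_setT in H; rewrite -[LHS]H.
  apply/esym/eq_measure_integral => A mA _.
  by apply: product_measure_unique => // B C mB mC; exact: XY.
rewrite fubini_tonelli2// (integral_against_density (f := g))//.
- apply: eq_integral => y _; congr (_ * _)%E.
  rewrite /fubini_G (integral_against_density (f := f))//.
  by apply/measurable_EFinP; exact: (measurableT_comp mphi).
- exact: measurable_fun_fubini_tonelli_G.
- by move=> y; apply: integral_ge0.
Qed.

(** The minimum selects the branch: on either side of the peak b - a, the exponent of the
other side is nonnegative. *)
Definition asymmetric_laplace (a b u : R) : R :=
  (a + b)^-1 * expR (Num.min (- (u - (b - a)) / a) ((u - (b - a)) / b)).

Lemma asymmetric_laplaceE (a b u : R) : 0 < a -> 0 < b ->
  asymmetric_laplace a b u = (a + b)^-1 *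
    expR (if b - a <= u then - (u - (b - a)) / a else (u - (b - a)) / b).
Proof.
move=> a0 b0; rewrite /asymmetric_laplace; congr (_ * expR _).
have [u0|u0] := leP (b - a) u.
- apply/min_idPl; apply: (@le_trans _ _ 0).
    by rewrite mulNr oppr_le0 divr_ge0 ?subr_ge0// ltW.
  by rewrite divr_ge0 ?subr_ge0// ltW.
- apply/min_idPr; apply: (@le_trans _ _ 0).
    by rewrite pmulr_lle0 ?invr_gt0// subr_le0 ltW.
  by rewrite mulNr oppr_ge0 pmulr_lle0 ?invr_gt0// subr_le0 ltW.
Qed.

Lemma asymmetric_laplace_nnm (a b : R) : 0 < a -> 0 < b ->
  nonneg_measurable (asymmetric_laplace a b).
Proof.
move=> a0 b0; split=> [|u]; last first.
  by rewrite mulr_ge0 ?expR_ge0// invr_ge0 ltW// addr_gt0.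
apply: measurable_funM => //; apply: (measurableT_comp (@measurable_expR R)).
apply: measurable_minr; apply: measurable_funM => //.
  by apply: (measurableT_comp (@oppr_measurable R _)); exact: measurable_funB.
exact: measurable_funB.
Qed.

Lemma asymmetric_laplace_tse (a b : R) : 0 < a -> 0 < b ->
  two_sided_exponential (asymmetric_laplace a b) (b - a).
Proof.
move=> a0 b0; have ab0 : 0 < (a + b)^-1 by rewrite invr_gt0 addr_gt0.
split; left.
- exists (ln (a + b)^-1 - (b - a) / b), b^-1 => u um.
  rewrite asymmetric_laplaceE// -{1}(lnK (x := (a + b)^-1))// -expRD; congr expR.
  case: ifP => mu'; last by field; rewrite gt_eqF.
  have -> : u = b - a by lra.
  by rewrite subrr oppr0 !mul0r addr0; field; rewrite gt_eqF.
- exists (ln (a + b)^-1 + (b - a) / a), (- a^-1) => u mu'.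
  rewrite asymmetric_laplaceE// mu' -{1}(lnK (x := (a + b)^-1))// -expRD; congr expR.
  by field; rewrite gt_eqF.
Qed.

(** The integrand is a single exponential of y on a half-line [y0, +oo); which of the two
indicators determines y0 depends on the side of the peak on which u lies. *)
Lemma asymmetric_laplace_convolution (a b u : R) : 0 < a -> 0 < b ->
  (\int[mu]_y (a^-1 * gamma_pdf ((u + b * y) / a) * gamma_pdf y)%:E =
   (asymmetric_laplace a b u)%:E)%E.
Proof.
move=> a0 b0; rewrite asymmetric_laplaceE//.
pose c := (a + b) / a; have c0 : 0 < c by rewrite divr_gt0// addr_gt0.
pose K := - 2 - u / a; pose y0 := Num.max (-1) (- (a + u) / b).
transitivity (\int[mu]_y (a^-1%:E * (if y0 <= y then expR (K - c * y) else 0)%:E))%E.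
  apply: eq_integral => y _; rewrite -EFinM -mulrA; congr (_ * _)%:E.
  have -> : (y0 <= y) = (-1 <= (u + b * y) / a) && (-1 <= y).
    rewrite /y0 ge_max andbC; congr (_ && _).
    rewrite ler_pdivrMr// ler_pdivlMr//; apply/idP/idP; lra.
  rewrite !gamma_pdfE; case: leP => _ /=; last by rewrite mul0r.
  case: leP => _ /=; last by rewrite mulr0.
  rewrite -expRD; congr expR; rewrite /K /c; field; rewrite gt_eqF//.
rewrite ge0_integralZl//; last 3 first.
- apply/measurable_EFinP; apply: measurable_fun_ifT => //.
    exact: measurable_fun_ler.
  apply: (measurableT_comp (@measurable_expR R)).
  by apply: measurable_funB => //; exact: measurable_funM.
- by move=> y _; rewrite lee_fin; case: ifP => // _; exact: expR_ge0.
- by rewrite lee_fin invr_ge0 ltW.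
rewrite integral_exp_tail// -EFinM; congr EFin.
have -> : a^-1 * (expR (K - c * y0) / c) = (a + b)^-1 * expR (K - c * y0).
  by rewrite /c; field; rewrite !gt_eqF// addr_gt0.
congr (_ * expR _); rewrite /y0; have [u0|u0] := leP (b - a) u.
- have -> : Num.max (-1) (- (a + u) / b) = -1.
    by apply/max_idPl; rewrite ler_pdivrMr//; lra.
  by rewrite /K /c; field; rewrite gt_eqF.
- have -> : Num.max (-1) (- (a + u) / b) = - (a + u) / b.
    by apply/max_idPr; rewrite ler_pdivlMr//; lra.
  by rewrite /K /c; field; rewrite !gt_eqF.
Qed.

Section mixtures.
Variables (d : measure_display) (T : measurableType d) (P : probability T R).
Variables (G G' Y : {RV P >-> R}).
Hypotheses (hG : is_density G (@gamma_pdf R)) (hG' : is_density G' (@gamma_pdf R)).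
Hypothesis hind : independent_RV2 G G'.

(** For a fixed value y of Gamma', the substitution u = a x - b y turns the double integral
into that of [asymmetric_laplace_convolution]. *)
Lemma asymmetric_laplace_density (a b : R) : 0 < a -> 0 < b ->
  (forall w, Y w = a * G w - b * G' w) -> is_density Y (asymmetric_laplace a b).
Proof.
move=> a0 b0 YE; have [mal al0] := asymmetric_laplace_nnm a0 b0.
have [mg g0] := @gamma_pdf_nnm R.
split => // A mA.
pose phi (z : R * R) : R := \1_A (a * z.1 - b * z.2).
have mlin : measurable_fun [set: R * R] (fun z => a * z.1 - b * z.2).
  by apply: measurable_funB; exact: measurable_funM.
have mphi : measurable_fun [set: R * R] phi.
  by apply: (measurableT_comp (measurable_indic mA)).
have -> : distribution P Y A = (\int[P]_w (phi (G w, G' w))%:E)%E.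
  by rewrite (distribution_indic Y mA); apply: eq_integral => w _; rewrite /phi/= YE.
rewrite (expectation_independent hG hG' hind)//.
pose H (z : R * R) : R := \1_A z.1 * (a^-1 * gamma_pdf ((z.1 + b * z.2) / a) * gamma_pdf z.2).
have H0 z : 0 <= H z by rewrite /H !mulr_ge0// invr_ge0 ltW.
have mH : measurable_fun [set: R * R] H.
  apply: measurable_funM; first exact: (measurableT_comp (measurable_indic mA)).
  apply: measurable_funM; last exact: (measurableT_comp mg).
  apply: measurable_funM => //; apply: (measurableT_comp mg).
  apply: measurable_funM => //; apply: measurable_funD => //.
  exact: measurable_funM.
have mEH : measurable_fun [set: R * R] (EFin \o H) by exact/measurable_EFinP.
have EH0 z : (0 <= (EFin \o H) z)%E by rewrite lee_fin.
transitivity (\int[mu]_y \int[mu]_u (EFin \o H) (u, y))%E.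
  apply: eq_integral => y _.
  pose h (u : R) : \bar R := (\1_A u * gamma_pdf ((u + b * y) / a))%:E.
  have mh : measurable_fun [set: R] h.
    apply/measurable_EFinP; apply: measurable_funM; first exact: measurable_indic.
    apply: (measurableT_comp mg); apply: measurable_funM => //.
    exact: measurable_funD.
  have h0 u : (0 <= h u)%E by rewrite lee_fin mulr_ge0.
  have -> : (\int[mu]_x (phi (x, y) * gamma_pdf x)%:E = \int[mu]_x h (a * x + - (b * y))%R)%E.
    apply: eq_integral => x _; rewrite /h /phi/=; congr (_ * gamma_pdf _)%:E.
    by field; rewrite gt_eqF.
  rewrite (integral_affine _ a0 mh h0) muleC muleA -EFinM.
  have c0 : (0 <= (gamma_pdf y / a)%:E)%E by rewrite lee_fin divr_ge0// ltW.
  have mh' : measurable_fun setT (h : measurableTypeR R -> \bar R) by [].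
  rewrite -(ge0_integralZl mu measurableT mh' (fun u _ => h0 u) c0).
  by apply: eq_integral => u _; rewrite /H /h/= -EFinM; congr EFin; ring.
rewrite -fubini_tonelli// [RHS]integral_mkcond; apply: eq_integral => u _.
rewrite patchE; case: ifPn => uA.
  rewrite -asymmetric_laplace_convolution//; apply: eq_integral => y _.
  by rewrite /H/= indicE uA mul1r.
by apply: integral0_eq => y _; rewrite /H/= indicE (negbTE uA) mul0r.
Qed.

End mixtures.

Lemma is_density_scale d (T : measurableType d) (P : probability T R)
    (X Y : {RV P >-> R}) (f : R -> R) (a : R) : 0 < a -> is_density X f ->
  (forall w, Y w = a * X w) -> is_density Y (fun x => a^-1 * f (x / a)).
Proof.
move=> a0 df YE; have [mf f0 XE] := df.
have m1 : measurable_fun [set: R] (fun x => a^-1 * f (x / a)).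
  by apply: measurable_funM => //; apply: (measurableT_comp mf); exact: measurable_funM.
split => [//|x|A mA]; first by rewrite mulr_ge0// invr_ge0 ltW.
pose h (u : R) : \bar R := (\1_A u * f (u / a))%:E.
have mh : measurable_fun [set: R] h.
  apply/measurable_EFinP; apply: measurable_funM; first exact: measurable_indic.
  by apply: (measurableT_comp mf); exact: measurable_funM.
have h0 u : (0 <= h u)%E by rewrite lee_fin mulr_ge0.
transitivity (mean f (fun x => \1_A (a * x))).
  rewrite -(expectation_density df); last first.
    split=> [|x]; last by [].
    by apply: (measurableT_comp (measurable_indic mA)); exact: measurable_funM.
  by rewrite (distribution_indic Y mA); apply: eq_integral => w _; rewrite YE.
transitivity (\int[mu]_x h (a * x + 0)%R)%E.
  rewrite unlock; apply: eq_integral => x _; rewrite /h addr0; congr (_ * f _)%:E.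
  by field; rewrite gt_eqF.
rewrite integral_affine// -ge0_integralZl//; last by rewrite lee_fin invr_ge0 ltW.
rewrite [RHS]integral_mkcond; apply: eq_integral => u _.
rewrite patchE /h indicE; case: ifPn => uA; last by rewrite mul0r mule0.
by rewrite mul1r.
Qed.

Lemma is_density_opp d (T : measurableType d) (P : probability T R)
    (X Y : {RV P >-> R}) (f : R -> R) : is_density X f ->
  (forall w, Y w = - X w) -> is_density Y (flip f).
Proof.
move=> df YE; have nf := is_density_nnm df; have [mff ff0] := flip_nnm nf.
split => // A mA.
have nA : nonneg_measurable (fun x : R => \1_A x : R).
  by split=> [|x]; [exact: measurable_indic|].
transitivity (mean f (fun x => \1_A (- x))).
  rewrite -(expectation_density df); last exact: (flip_nnm nA).
  by rewrite (distribution_indic Y mA); apply: eq_integral => w _; rewrite YE.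
rewrite -mean_flip// unlock [RHS]integral_mkcond; apply: eq_integral => u _.
by rewrite patchE indicE; case: ifPn => uA; rewrite ?mul1r// mul0r.
Qed.

End asymmetric_laplace.

(** * Continuity of the moments of Gamma^s *)

Section powers.
Variable R : realType.

Lemma continuous_powR_gt0 (r x : R) : 0 < x -> continuous_at x (fun y : R => y `^ r).
Proof.
move=> x0; apply: differentiable_continuous; apply/derivable1_diffP.
exact: (@ex_derive _ _ _ _ _ _ _ (is_derive1_powR r x0)).
Qed.

Lemma continuous_pos_powR (r : R) : 0 < r -> continuous (fun x : R => pos x `^ r).
Proof.
move=> r0.
have cpos : continuous (@pos R).
  move=> x; apply: continuous_max; [exact: cvg_id|exact: cvg_cst].
move=> x; have [x0|x0] := ltP 0 x.
  apply: (@continuous_comp R R R (@pos R) (fun y => y `^ r)); first exact: cpos.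
  apply: continuous_powR_gt0.
  by have [[? ->]|[? ->]] := posP x => //; lra.
have px : pos x = 0 by have [[? ->]|[? ->]] := posP x => //; lra.
apply/cvgrPdist_lt => e e0; rewrite px powR0 ?gt_eqF//.
have e'0 : 0 < e `^ r^-1 by exact: powR_gt0.
have /cvgrPdist_lt/(_ _ e'0) := cpos x; rewrite px.
apply: filterS => y; rewrite !sub0r !normrN !ger0_norm ?pos_ge0 ?powR_ge0// => ye.
have -> : e = (e `^ r^-1) `^ r by rewrite -powRrM mulVf ?gt_eqF// powRr1// ltW.
by apply: gt0_ltr_powR; rewrite ?nnegrE ?pos_ge0 ?powR_ge0.
Qed.

Lemma powR_sum_bound (r a b : R) : 0 < r -> 0 <= a -> 0 <= b ->
  (2 * a + 2 * b) `^ r <= 4 `^ r * a `^ r + 4 `^ r * b `^ r.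
Proof.
move=> r0 a0 b0; pose M := Num.max a b.
have M0 : 0 <= M by rewrite /M le_max a0.
have [aM bM] : a <= M /\ b <= M by rewrite /M !le_max !lexx orbT.
apply: (@le_trans _ _ ((4 * M) `^ r)).
  by apply: ge0_ler_powR; rewrite ?nnegrE ?(ltW r0)//; lra.
rewrite powRM// -mulrDr ler_wpM2l ?powR_ge0// /M.
have pa := powR_ge0 a r; have pb := powR_ge0 b r.
have [->|->] : Num.max a b = a \/ Num.max a b = b by case: (leP a b) => _; [right|left].
  by lra.
by lra.
Qed.

End powers.

HB.lock Definition mixture_mean (R : realType) (d : measure_display)
    (T : measurableType d) (P : probability T R) (G G' : {RV P >-> R})
    (phi : R -> R) (s : R) : R :=
  (\int[P]_w phi (gamma_mix G G' s w))%R.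
Canonical unlockable_mixture_mean := Unlockable mixture_mean.unlock.

Section mixture_moments.
Variables (R : realType) (d : measure_display) (T : measurableType d).
Variables (P : probability T R) (G G' : {RV P >-> R}).
Hypotheses (hG : is_density G (@gamma_pdf R)) (hG' : is_density G' (@gamma_pdf R)).

Definition power_bounded (r : R) (phi : R -> R) :=
  [/\ continuous phi, forall t, 0 <= phi t & forall t, phi t <= `|t| `^ r].

Lemma measurable_gamma_mix s : measurable_fun [set: T] (gamma_mix G G' s).
Proof. by apply: measurable_funB; apply: measurable_funM. Qed.

Lemma gamma_abs_moment_fin (r : R) : 0 < r ->
  (mean (@gamma_pdf R) (fun x => `|x| `^ r)%R < +oo)%E.
Proof.
move=> r0; have ng := @gamma_pdf_nnm R; have cg := gamma_pdf_centered R.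
have lg := @gamma_pdf_log_concave R.
rewrite mean_abs_powR// lte_add_pinfty//.
  exact: (log_concave_moment ng lg (cd_mass cg)).
exact: (log_concave_moment (flip_nnm ng) (flip_log_concave lg)
  (cd_mass (flip_centered cg))).
Qed.

Lemma nnm_abs_powR (r : R) : nonneg_measurable (fun x : R => `|x| `^ r).
Proof.
split=> [|x]; last exact: powR_ge0.
apply: (measurableT_comp (@measurable_powR R r)).
exact: (measurableT_comp (@normr_measurable R _)).
Qed.

(** Dominates |Gamma^s|^r for all s in (-1, 2). *)
Let dom (r : R) (w : T) : R := 4 `^ r * `|G w| `^ r + 4 `^ r * `|G' w| `^ r.

Let dom_integrable (r : R) : 0 < r -> P.-integrable [set: T] (EFin \o dom r).
Proof.
move=> r0.
have one (Z : {RV P >-> R}) : is_density Z (@gamma_pdf R) ->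
    P.-integrable [set: T] (fun w => (`|Z w| `^ r)%:E).
  move=> dZ; apply/integrableP; split.
    apply/measurable_EFinP; apply: (measurableT_comp (@measurable_powR R r)).
    exact: measurableT_comp.
  under eq_integral do rewrite gee0_abs ?lee_fin ?powR_ge0//.
  have := expectation_density dZ (nnm_abs_powR r) => ->.
  exact: gamma_abs_moment_fin.
have -> : EFin \o dom r = ((fun w => (4 `^ r)%:E * (`|G w| `^ r)%:E) \+
                          (fun w => (4 `^ r)%:E * (`|G' w| `^ r)%:E))%E.
  by apply/funext => w.
by apply: integrableD => //; apply: integrableZl => //; exact: one.
Qed.

Let dom_bound (r s : R) (phi : R -> R) w : 0 < r -> power_bounded r phi ->
  -1 < s < 2 -> phi (gamma_mix G G' s w) <= dom r w.
Proof.
move=> r0 [_ _ pb] /andP[s1 s2]; apply: (le_trans (pb _)).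
apply: le_trans (powR_sum_bound r0 (normr_ge0 (G w)) (normr_ge0 (G' w))).
apply: ge0_ler_powR; rewrite ?nnegrE ?(ltW r0)//.
rewrite /gamma_mix; apply: (le_trans (ler_normB _ _)); rewrite !normrM.
by apply: lerD; apply: ler_wpM2r => //; rewrite ler_norml; lra.
Qed.

Lemma mixture_integrable (r s : R) (phi : R -> R) : 0 < r -> power_bounded r phi ->
  -1 < s < 2 -> P.-integrable [set: T] (EFin \o (phi \o gamma_mix G G' s)).
Proof.
move=> r0 pb s12; apply: le_integrable (dom_integrable r0) => //.
- apply/measurable_EFinP; apply: measurableT_comp; last exact: measurable_gamma_mix.
  by apply: continuous_measurable_fun; case: pb.
- move=> w _; rewrite !gee0_abs ?lee_fin; first exact: dom_bound.
    by rewrite /dom addr_ge0// mulr_ge0// powR_ge0.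
  by case: pb => _ + _; apply.
Qed.

Lemma mixture_meanE (r s : R) (phi : R -> R) : 0 < r -> power_bounded r phi ->
  0 <= s <= 1 ->
  (\int[P]_w (phi (gamma_mix G G' s w))%:E = (mixture_mean G G' phi s)%:E)%E.
Proof.
move=> r0 pb s01; rewrite unlock /Rintegral fineK//.
by apply: integrable_fin_num => //; apply: (mixture_integrable r0 pb); lra.
Qed.

(** The open interval (-1, 2) contains [0, 1], which spares one-sided limits at 0 and 1. *)
Lemma mixture_mean_continuous (r : R) (phi : R -> R) : 0 < r -> power_bounded r phi ->
  {within `[0, 1], continuous (mixture_mean G G' phi)}.
Proof.
move=> r0 pb; have [cphi phi0 _] := pb.
have H : {in `](-1)%R, 2%R[%classic, continuous (fun s => \int[P]_w phi (gamma_mix G G' s w))%R}.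
  apply: (@continuity_under_integral _ _ _ P (fun s w => phi (gamma_mix G G' s w))
    setT measurableT (-1) 2 _ _ (dom r)).
  - move=> s; rewrite /= in_itv/= => s12; exact: (mixture_integrable r0 pb).
  - apply: nearW => w _ s _; apply: (@continuous_comp _ _ _ (fun s => gamma_mix G G' s w) phi);
      last exact: cphi.
    rewrite /gamma_mix; apply: cvgB; first by apply: cvgM; [exact: cvg_id|exact: cvg_cst].
    apply: cvgM; last exact: cvg_cst.
    by apply: cvgB; [exact: cvg_cst|exact: cvg_id].
  - exact: dom_integrable.
  - move=> s; rewrite /= in_itv/= => s12; apply: nearW => w _.
    by rewrite ger0_norm//; exact: (dom_bound _ r0 pb).
have -> : mixture_mean G G' phi = (fun s => \int[P]_w phi (gamma_mix G G' s w))%R.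
  by apply/funext => s; rewrite unlock.
apply: continuous_in_subspaceT => s; rewrite inE/= in_itv/= => s01.
by apply: H; rewrite inE/= in_itv/=; lra.
Qed.

End mixture_moments.

(** * The density of c Gamma^s *)

Section scaled_mixtures.
Variables (R : realType) (d : measure_display) (T : measurableType d).
Variables (P : probability T R) (G G' : {RV P >-> R}).
Hypotheses (hG : is_density G (@gamma_pdf R)) (hG' : is_density G' (@gamma_pdf R)).
Hypothesis hind : independent_RV2 G G'.

Lemma random_variable_of (f : T -> R) : measurable_fun [set: T] f ->
  exists Z : {RV P >-> R}, forall w, Z w = f w.
Proof.
move=> mf; pose mix := isMeasurableFun.Build _ _ _ _ f mf.
pose Z : {mfun T >-> R} := HB.pack f mix.
by exists Z.
Qed.

Lemma scaled_mixture (c s : R) : 0 < c -> exists Y : {RV P >-> R},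
  forall w, Y w = c * gamma_mix G G' s w.
Proof.
by move=> c0; apply: random_variable_of; apply: measurable_funM => //;
  exact: measurable_gamma_mix.
Qed.

Lemma scaled_mixture_centered (c s : R) (Y : {RV P >-> R}) :
  (forall w, Y w = c * gamma_mix G G' s w) -> centered Y.
Proof.
move=> YE; have [iG EG] := centered_density_expectation hG (gamma_pdf_centered R).
have [iG' EG'] := centered_density_expectation hG' (gamma_pdf_centered R).
rewrite /centered unlock.
have -> : (\int[P]_w (EFin \o Y) w = \int[P]_w (((c * s)%:E * (EFin \o G) w) +
    ((- (c * (1 - s)))%:E * (EFin \o G') w)))%E.
  apply: eq_integral => w _; rewrite /= YE /gamma_mix -!EFinM -EFinD; congr EFin; ring.
move: EG EG'; rewrite /centered unlock => EG EG'.
rewrite integralD//; [|exact: integrableZl|exact: integrableZl].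
by rewrite !integralZl// EG EG' !mule0 adde0.
Qed.

Lemma scaled_mixture_density (c s : R) (Y : {RV P >-> R}) : 0 < c -> 0 <= s <= 1 ->
    (forall w, Y w = c * gamma_mix G G' s w) ->
  exists g m, [/\ is_density Y g, two_sided_exponential g m, centered_density g,
    s = 1 -> forall x, x < m -> g x = 0 & s = 0 -> forall x, m < x -> g x = 0].
Proof.
move=> c0 /andP[s0 s1] YE; have cY := scaled_mixture_centered YE.
suff [g [m [dg tg g1 g0]]] : exists g m, [/\ is_density Y g, two_sided_exponential g m,
    s = 1 -> forall x, x < m -> g x = 0 & s = 0 -> forall x, m < x -> g x = 0].
  by exists g, m; split => //; exact: is_density_centered dg cY.
pose g1 (x : R) := c^-1 * gamma_pdf (x / c).
have g1_left x : x < - c -> g1 x = 0.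
  move=> xc; rewrite /g1 gamma_pdfE ifF ?mulr0//; apply/negbTE; rewrite -ltNge.
  by rewrite ltr_pdivrMr// mulN1r.
have g1_right x : - c <= x -> g1 x = expR ((ln c^-1 - 1) + (- c^-1) * x).
  move=> xc; rewrite /g1 gamma_pdfE ifT; last by rewrite ler_pdivlMr// mulN1r.
  rewrite -[in LHS](lnK (x := c^-1)) ?posrE ?invr_gt0// -expRD; congr expR.
  by rewrite lnK ?posrE ?invr_gt0//; field; rewrite gt_eqF.
have [s10|s10] := eqVneq s 1.
  exists g1, (- c); split.
  - by apply: (is_density_scale c0 hG) => w; rewrite YE /gamma_mix s10 subrr mul0r subr0 mul1r.
  - by split; [right|left; exists (ln c^-1 - 1), (- c^-1)].
  - by move=> _; exact: g1_left.
  - by rewrite s10 => /eqP; rewrite oner_eq0.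
have [s00|s00] := eqVneq s 0.
  have [Z ZE] : exists Z : {RV P >-> R}, forall w, Z w = c * G' w.
    by apply: random_variable_of; exact: measurable_funM.
  have dZ := is_density_scale c0 hG' ZE.
  exists (flip g1), c; split.
  - by apply: (is_density_opp dZ) => w; rewrite YE ZE /gamma_mix s00; ring.
  - split; last by right => x cx; apply: g1_left; rewrite ltrN2.
    left; exists (ln c^-1 - 1), c^-1 => x xc; rewrite /flip g1_right ?lerN2//.
    by rewrite mulrN mulNr opprK.
  - by rewrite s00 => /eqP; rewrite eq_sym oner_eq0.
  - by move=> _ x cx; apply: g1_left; rewrite ltrN2.
have cs0 : 0 < c * s by rewrite mulr_gt0// lt_neqAle eq_sym s00.
have cs1 : 0 < c * (1 - s) by rewrite mulr_gt0// subr_gt0 lt_neqAle s10.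
exists (asymmetric_laplace (c * s) (c * (1 - s))), (c * (1 - s) - c * s); split.
- apply: (asymmetric_laplace_density hG hG' hind) => // w.
  by rewrite YE /gamma_mix; ring.
- exact: asymmetric_laplace_tse.
- by move/eqP; rewrite (negbTE s10).
- by move/eqP; rewrite (negbTE s00).
Qed.

End scaled_mixtures.

(** * Norm ratios *)

Section norm_ratios.
Variables (R : realType) (d : measure_display) (T : measurableType d).
Variable P : probability T R.

Lemma norm_ratioE (p q A B : R) (Z : T -> R) : 0 < p -> 0 < q ->
    (\int[P]_w (`|Z w| `^ p)%:E = A%:E)%E -> (\int[P]_w (`|Z w| `^ q)%:E = B%:E)%E ->
    0 < A ->
  norm_ratio P q p Z = (B `^ q^-1 / A `^ p^-1)%:E.
Proof.
move=> p0 q0 AE BE A0; rewrite /norm_ratio !unlock.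
have -> : (\int[P]_x (`|(EFin \o Z) x| `^ q) = B%:E)%E by rewrite -BE.
have -> : (\int[P]_x (`|(EFin \o Z) x| `^ p) = A%:E)%E by rewrite -AE.
rewrite !poweR_EFin inver gt_eqF ?powR_gt0//.
Qed.

End norm_ratios.

(** * The extremal mixture *)

Lemma within_continuousP (R : realType) (A : set R) (f : R -> R) :
  {within A, continuous f} <->
  forall s : R, A s -> f x @[x --> within A (nbhs s)] --> f s.
Proof. exact: subspace_continuousP. Qed.

Section extremal_mixture.
Variables (R : realType) (d' : measure_display) (T' : measurableType d').
Variables (Q : probability T' R) (G G' : {RV Q >-> R}).
Hypotheses (hG : is_density G (@gamma_pdf R)) (hG' : is_density G' (@gamma_pdf R)).
Hypothesis hind : independent_RV2 G G'.

Let pp (r x : R) := pos x `^ r.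
Let np (r x : R) := pos (- x) `^ r.
Let ap (r x : R) := `|x| `^ r.

Let pp_bounded (r : R) : 0 < r -> power_bounded r (pp r).
Proof.
move=> r0; split=> [|t|t]; [exact: continuous_pos_powR|exact: powR_ge0|].
apply: ge0_ler_powR; rewrite ?nnegrE ?pos_ge0 ?(ltW r0)//.
by rewrite norm_pos lerDl pos_ge0.
Qed.

Let np_bounded (r : R) : 0 < r -> power_bounded r (np r).
Proof.
move=> r0; have [c _ b] := pp_bounded r0; split=> [t|t|t]; [|exact: powR_ge0|].
  apply: (@continuous_comp R R R -%R (pp r)); [exact: opp_continuous|exact: c].
by rewrite -normrN; exact: b.
Qed.

Let ap_bounded (r : R) : 0 < r -> power_bounded r (ap r).
Proof.
move=> r0; have [c _ _] := pp_bounded r0; have [c' _ _] := np_bounded r0.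
split=> [t|t|t //]; last exact: powR_ge0.
have -> : ap r = (fun x => pp r x + np r x).
  by apply/funext => x; exact: abs_powR_split.
by apply: cvgD; [exact: c|exact: c'].
Qed.

Let M (phi : R -> R) s := mixture_mean G G' phi s.

Let M_split (r s : R) : 0 < r -> 0 <= s <= 1 -> M (ap r) s = M (pp r) s + M (np r) s.
Proof.
move=> r0 s01; have s12 : -1 < s < 2 by lra.
have := mixture_meanE hG hG' r0 (ap_bounded r0) s01.
under eq_integral do rewrite /ap abs_powR_split// EFinD.
rewrite integralD//=; last 2 first.
- exact: (mixture_integrable hG hG' r0 (pp_bounded r0) s12).
- exact: (mixture_integrable hG hG' r0 (np_bounded r0) s12).
rewrite (mixture_meanE hG hG' r0 (pp_bounded r0) s01).
rewrite (mixture_meanE hG hG' r0 (np_bounded r0) s01).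
by rewrite -EFinD => -[].
Qed.

Let posM (c x : R) : 0 < c -> pos (c * x) = c * pos x.
Proof.
move=> c0; have [[x0 ->]|[x0 ->]] := posP x.
  by have [[? ->]|[h _]] := posP (c * x) => //; exfalso; move: h; rewrite pmulr_rlt0//; lra.
rewrite mulr0; have [[h _]|[_ ->]] := posP (c * x) => //.
by exfalso; move: h; rewrite pmulr_rge0//; lra.
Qed.

Let scaled_moments (c s r : R) (Y : {RV Q >-> R}) g : 0 < c -> 0 <= s <= 1 -> 0 < r ->
    (forall w, Y w = c * gamma_mix G G' s w) -> is_density Y g ->
  pos_moment r g = (c `^ r * M (pp r) s)%:E /\
  pos_moment r (flip g) = (c `^ r * M (np r) s)%:E.
Proof.
move=> c0 s01 r0 YE dg; have ng := is_density_nnm dg.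
have npp : nonneg_measurable (pp r).
  split=> [|x]; last exact: powR_ge0.
  by apply: (measurableT_comp (@measurable_powR R r)); exact: measurable_pos.
have s12 : -1 < s < 2 by lra.
split; rewrite /pos_moment ?mean_flip//.
- rewrite -(expectation_density dg npp) EFinM -(mixture_meanE hG hG' r0 (pp_bounded r0) s01).
  rewrite -integralZl//=; last exact: (mixture_integrable hG hG' r0 (pp_bounded r0) s12).
  apply: eq_integral => w _; rewrite YE -EFinM; congr EFin.
  by rewrite /pp posM// powRM ?pos_ge0 ?(ltW c0).
- rewrite -(expectation_density dg (flip_nnm npp)) EFinM.
  rewrite -(mixture_meanE hG hG' r0 (np_bounded r0) s01).
  rewrite -integralZl//=; last exact: (mixture_integrable hG hG' r0 (np_bounded r0) s12).
  apply: eq_integral => w _; rewrite YE -EFinM; congr EFin.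
  by rewrite /flip /pp /np -mulrN posM// powRM ?pos_ge0 ?(ltW c0).
Qed.

Let M_gt0 (r s : R) : 0 < r -> 0 <= s <= 1 -> 0 < M (ap r) s.
Proof.
move=> r0 s01.
have [Y YE] := @scaled_mixture _ _ _ _ G G' 1 s ltr01.
have [g [m [dg _ cg _ _]]] := scaled_mixture_density hG hG' hind ltr01 s01 YE.
rewrite -lte_fin -(mixture_meanE hG hG' r0 (ap_bounded r0) s01).
have -> : (\int[Q]_w (ap r (gamma_mix G G' s w))%:E = mean g (fun x => `|x| `^ r)%R)%E.
  rewrite -(expectation_density dg (nnm_abs_powR r)).
  by apply: eq_integral => w _; rewrite YE mul1r.
exact: mean_abs_powR_gt0 (cd_nnm cg) (cd_mass cg).
Qed.

Lemma mixture_norm_ratioE (p q s : R) : 0 < p -> 0 < q -> 0 <= s <= 1 ->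
  norm_ratio Q q p (gamma_mix G G' s) = (M (ap q) s `^ q^-1 / M (ap p) s `^ p^-1)%:E.
Proof.
move=> p0 q0 s01; apply: norm_ratioE => //.
- exact: (mixture_meanE hG hG' p0 (ap_bounded p0) s01).
- exact: (mixture_meanE hG hG' q0 (ap_bounded q0) s01).
- exact: M_gt0.
Qed.

Lemma mixture_norm_ratio_max (p q : R) : 0 < p -> 0 < q ->
  exists2 s0 : R, 0 <= s0 <= 1 & forall s : R, 0 <= s <= 1 ->
    (norm_ratio Q q p (gamma_mix G G' s) <= norm_ratio Q q p (gamma_mix G G' s0))%E.
Proof.
move=> p0 q0; pose rho s := M (ap q) s `^ q^-1 / M (ap p) s `^ p^-1.
have croot (r : R) : 0 < r -> {within `[0, 1], continuous (fun s => M (ap r) s `^ r^-1)}.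
  move=> r0; have cM := mixture_mean_continuous hG hG' r0 (ap_bounded r0).
  apply/within_continuousP => s s01.
  have Ms : 0 < M (ap r) s by apply: M_gt0 => //; move: s01; rewrite /= in_itv.
  have H := (within_continuousP _ _).1 cM s s01.
  exact: (@cvg_comp _ _ _ (M (ap r)) (fun y : R => y `^ r^-1) _ _ _ H
    (continuous_powR_gt0 Ms)).
have crho : {within `[0, 1], continuous rho}.
  apply/within_continuousP => s s01.
  have h1 := (within_continuousP _ _).1 (croot q q0) s s01.
  have h2 := (within_continuousP _ _).1 (croot p p0) s s01.
  apply: cvgM; [exact: h1|apply: cvgV; [|exact: h2]].
  by rewrite gt_eqF// powR_gt0//; apply: M_gt0 => //; move: s01; rewrite /= in_itv.
have [s0 s001 rho_max] := EVT_max ler01 crho.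
have s00 : 0 <= s0 <= 1 by move: s001; rewrite in_itv.
exists s0 => // s s01.
rewrite (mixture_norm_ratioE p0 q0 s01) (mixture_norm_ratioE p0 q0 s00) lee_fin.
by apply: rho_max; rewrite in_itv.
Qed.

Variables (d : measure_display) (T : measurableType d) (P : probability T R).
Variable X : {RV P >-> R}.
Hypotheses (hX : log_concave X) (hX0 : centered X).

Lemma log_concave_norm_ratio_le (p q : R) : 1 < p -> p < q ->
  exists2 s : R, 0 <= s <= 1 &
    (norm_ratio P q p X <= norm_ratio Q q p (gamma_mix G G' s))%E.
Proof.
move=> p1 pq; have p0 : 0 < p by lra. have q0 : 0 < q by lra.
have [f [df cvf]] := hX; have lf := log_concave_funP cvf.
have cf := is_density_centered df hX0; have nf := cd_nnm cf.
have cf' := flip_centered cf; have nf' := cd_nnm cf'; have lf' := flip_log_concave lf.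
have fin (r : R) (h : R -> R) : 0 < r -> centered_density h -> log_concave_fun h ->
    exists2 a, 0 <= a & pos_moment r h = a%:E.
  move=> r0 ch lh; have nh := cd_nnm ch.
  have := log_concave_moment nh lh (cd_mass ch) r0.
  have : (0 <= pos_moment r h)%E.
    apply: mean_ge0 => //; split=> [|x]; last exact: powR_ge0.
    by apply: (measurableT_comp (@measurable_powR R r)); exact: measurable_pos.
  rewrite -/(pos_moment r h); case: (pos_moment r h) => [a|//|//].
  by rewrite lee_fin => a0 _; exists a.
have [a a0 aE] := fin p f p0 cf lf; have [b b0 bE] := fin p _ p0 cf' lf'.
have [a2 a20 a2E] := fin q f q0 cf lf; have [b2 b20 b2E] := fin q _ q0 cf' lf'.
have XE r : 0 < r -> (\int[P]_w (`|X w| `^ r)%:E = pos_moment r f + pos_moment r (flip f))%E.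
  by move=> r0; rewrite -mean_abs_powR// -(expectation_density df (nnm_abs_powR r)).
have ab0 : 0 < a + b.
  rewrite -lte_fin EFinD -aE -bE -mean_abs_powR//.
  exact: mean_abs_powR_gt0 (cd_mass cf).
(* The scale giving c s * Gamma^s the p-th absolute moment a + b of X. *)
pose c s := ((a + b) / M (ap p) s) `^ p^-1.
have c0 s : 0 <= s <= 1 -> 0 < c s.
  by move=> s01; rewrite powR_gt0// divr_gt0// M_gt0.
have cp s : 0 <= s <= 1 -> c s `^ p = (a + b) / M (ap p) s.
  move=> s01; rewrite -powRrM mulVf ?gt_eqF// powRr1//.
  by rewrite ltW// divr_gt0// M_gt0.
have cpM s : 0 <= s <= 1 -> c s `^ p * M (ap p) s = a + b.
  by move=> s01; rewrite cp// divfK// gt_eqF// M_gt0.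
have s0 : 0 <= (0 : R) <= 1 by rewrite lexx ler01.
have s1 : 0 <= (1 : R) <= 1 by rewrite lexx ler01.
have end1 : a * M (ap p) 1 <= (a + b) * M (pp p) 1.
  have [Y YE] := @scaled_mixture _ _ _ _ G G' (c 1) 1 (c0 _ s1).
  have [g [m [dg tg cg g0 _]]] := scaled_mixture_density hG hG' hind (c0 _ s1) s1 YE.
  have [E1 E2] := scaled_moments (c0 _ s1) s1 p0 YE dg.
  have := pos_moment_endpoint cf cg lf tg p1 (g0 erefl).
  rewrite aE bE E1 E2 -!EFinD -mulrDr -M_split// cpM// ltry => /(_ isT erefl).
  by rewrite lee_fin cp// mulrAC ler_pdivlMr// M_gt0.
have end0 : b * M (ap p) 0 <= (a + b) * M (np p) 0.
  have [Y YE] := @scaled_mixture _ _ _ _ G G' (c 0) 0 (c0 _ s0).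
  have [g [m [dg tg cg _ g0]]] := scaled_mixture_density hG hG' hind (c0 _ s0) s0 YE.
  have [E1 E2] := scaled_moments (c0 _ s0) s0 p0 YE dg.
  have tg' : two_sided_exponential (flip g) (- m).
    case: tg => tl tr; split.
    - case: tr => [[k [l H]]|H]; [left|right].
        by exists k, (- l) => x xm; rewrite /flip H ?mulrN ?mulNr//; lra.
      by move=> x xm; apply: H; lra.
    - case: tl => [[k [l H]]|H]; [left|right].
        by exists k, (- l) => x xm; rewrite /flip H ?mulrN ?mulNr//; lra.
      by move=> x xm; apply: H; lra.
  have gN x : x < - m -> flip g x = 0 by move=> xm; apply: (g0 erefl); lra.
  have flipK h : flip (flip h) = h by apply/funext => x; rewrite /flip opprK.
  have := pos_moment_endpoint cf' (flip_centered cg) lf' tg' p1 gN.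
  have tot : (b%:E + a%:E =
      (c 0 `^ p * M (np p) 0)%:E + (c 0 `^ p * M (pp p) 0)%:E)%E.
    by rewrite -!EFinD -mulrDr [M (np p) 0 + _]addrC -M_split// cpM// addrC.
  rewrite !flipK aE bE E1 E2 ltry => /(_ isT tot).
  by rewrite lee_fin cp// mulrAC ler_pdivlMr// M_gt0.
(* psi s = 0 says that X and Gamma^s have the same proportion of positive p-th moment. *)
pose psi s := (a + b) * M (pp p) s - a * M (ap p) s.
have [s s01 psi0] : exists2 s, s \in `[0, 1]%R & psi s = 0.
  apply: IVT => //.
    apply/within_continuousP => s s01.
    have h1 := (within_continuousP _ _).1 (mixture_mean_continuous hG hG' p0 (pp_bounded p0)) s s01.
    have h2 := (within_continuousP _ _).1 (mixture_mean_continuous hG hG' p0 (ap_bounded p0)) s s01.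
    by apply: cvgB; apply: cvgM; [exact: cvg_cst|exact: h1|exact: cvg_cst|exact: h2].
  have psi_1 : 0 <= psi 1 by rewrite /psi subr_ge0.
  have psi_0 : psi 0 <= 0.
    rewrite /psi; have -> : M (pp p) 0 = M (ap p) 0 - M (np p) 0.
      by rewrite (M_split p0 s0) addrK.
    by move: end0; lra.
  by rewrite ge_min le_max psi_0 psi_1 orbT.
rewrite in_itv/= in s01; exists s => //.
have [Y YE] := @scaled_mixture _ _ _ _ G G' (c s) s (c0 _ s01).
have [g [m [dg tg cg _ _]]] := scaled_mixture_density hG hG' hind (c0 _ s01) s01 YE.
have [Ep1 Ep2] := scaled_moments (c0 _ s01) s01 p0 YE dg.
have [Eq1 Eq2] := scaled_moments (c0 _ s01) s01 q0 YE dg.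
have Ms := M_gt0 p0 s01.
have aM : c s `^ p * M (pp p) s = a.
  have : a * M (ap p) s = (a + b) * M (pp p) s by move: psi0; rewrite /psi; lra.
  rewrite cp// => E; apply: (mulIf (lt0r_neq0 Ms)).
  by rewrite E mulrAC divfK ?gt_eqF.
have bM : c s `^ p * M (np p) s = b.
  by have := cpM s s01; rewrite M_split// mulrDr aM => /addrI.
have [] := pos_moment_comparison cf cg lf tg p1 pq.
- by rewrite aE Ep1 aM.
- by rewrite bE Ep2 bM.
- by rewrite Ep1 ltry.
- by rewrite Ep2 ltry.
rewrite a2E b2E Eq1 Eq2 !lee_fin => le1 le2.
rewrite (mixture_norm_ratioE p0 q0 s01).
rewrite (norm_ratioE (p := p) (q := q) (A := a + b) (B := a2 + b2) p0 q0 _ _ ab0).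
- have cs := c0 _ s01; have Mq := M_gt0 q0 s01.
  have root (r B : R) : 0 < r -> 0 < B -> (c s `^ r * B) `^ r^-1 = c s * B `^ r^-1.
    move=> r0 B0; rewrite powRM ?powR_ge0 ?(ltW B0)// -powRrM mulfV ?gt_eqF//.
    by rewrite powRr1// ltW.
  have -> : M (ap q) s `^ q^-1 / M (ap p) s `^ p^-1 =
      (c s `^ q * M (ap q) s) `^ q^-1 / (c s `^ p * M (ap p) s) `^ p^-1.
    by rewrite !root// -mulf_div divff ?mul1r// gt_eqF.
  rewrite cpM// lee_fin ler_wpM2r ?invr_ge0 ?powR_ge0//.
  have le12 : a2 + b2 <= c s `^ q * M (ap q) s by rewrite M_split// mulrDr lerD.
  apply: ge0_ler_powR; rewrite ?nnegrE ?invr_ge0 ?(ltW q0) ?addr_ge0//.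
  by apply: le_trans le12; exact: addr_ge0.
- by rewrite XE// aE bE.
- by rewrite XE// a2E b2E.
Qed.

End extremal_mixture.

Theorem theorem12 (R : realType) (p q : R) (hp : 1 < p) (hpq : p < q)
    (d' : measure_display) (T' : measurableType d') (Q : probability T' R)
    (G G' : {RV Q >-> R})
    (hG : is_density G (@gamma_pdf R)) (hG' : is_density G' (@gamma_pdf R))
    (hind : independent_RV2 G G')
    (d : measure_display) (T : measurableType d) (P : probability T R)
    (X : {RV P >-> R}) (hX : log_concave X) (hX0 : centered X) :
  exists s0 : R,
    [/\ 0 <= s0 <= 1,
        forall s : R, 0 <= s <= 1 ->
          (norm_ratio Q q p (gamma_mix G G' s) <=
           norm_ratio Q q p (gamma_mix G G' s0))%E &
        (norm_ratio P q p X <= norm_ratio Q q p (gamma_mix G G' s0))%E].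
Proof.
have p0 : 0 < p by apply: lt_trans hp.
have [s0 s001 smax] := mixture_norm_ratio_max hG hG' hind p0 (lt_trans p0 hpq).
have [s s01 Xs] := log_concave_norm_ratio_le hG hG' hind hX hX0 hp hpq.
by exists s0; split => //; apply: (le_trans Xs); exact: smax.
Qed.
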